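(* Let $d=2$ and assume the non-degeneracy condition $$\tilde U''(\theta_0)\neq 0\quad\text{for all }\theta_0\in\mathcal M(\tilde U).$$ Then for any $\theta_\pm\in\mathbb R$ satisfying $|\theta_+-\theta_-|>\pi$, there is a constant $\bar\alpha=\bar\alpha(U,\theta_\pm)\in(0,2)$ such that for any $\alpha\in(\bar\alpha,2)$ and any $h>0$, there is an $h$-energy solution $x:\mathbb R\to\mathbb C$ of $\ddot x=\nabla U(x)$, defined on all of $\mathbb R$ (a bi-hyperbolic solution), satisfying $$x(t)=\sqrt{2h}\,|t|\,e^{i\theta_\pm}+o(|t|),\quad\text{as }t\to\pm\infty.$$
   Context: Identify $\mathbb R^2\simeq\mathbb C$. For $\alpha\in(0,2)$, the potential is $U(x)=|x|^{-\alpha}U(x/|x|)$ on $\mathbb C\setminus\{0\}$, where the restriction of $U$ to the unit circle is a fixed positive $C^2$ function; $\tilde U:\mathbb R\to\mathbb R$ is $\tilde U(\theta)=U(e^{i\theta})$ (it does not depend on $\alpha$), and $\bar\alpha$ depends only on $\tilde U$ and $\theta_\pm$. $\mathcal M(\tilde U)=\{\theta_0\in\mathbb R:\tilde U(\theta_0)\le\tilde U(\theta)\ \forall\theta\in\mathbb R\}$ is the set of global minimizers of $\tilde U$. Solutions take values in $\mathbb C\setminus\{0\}$; an $h$-energy solution has $\frac12|\dot x|^2-U(x)\equiv h$. A positive energy solution with maximal domain $\mathbb R$ is called bi-hyperbolic. *)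

(* Defs.v *)
From Stdlib Require Export Reals.
From Coquelicot Require Export Coquelicot.

Open Scope R_scope.

Definition cis (theta : R) : C := (cos theta, sin theta).

(* The fixed data is a function [u] on the unit circle.  It is represented by
   a total function on [C]; every definition below uses only its values on the
   circle, except at the origin, which solutions avoid. *)
Definition angular (u : C -> R) (theta : R) : R := u (cis theta).

Definition potential (alpha : R) (u : C -> R) (z : C) : R :=
  Rpower (Cmod z) (- alpha) * u (z / RtoC (Cmod z))%C.

(* [Derive] is total, so [ex_derive_n f 2] alone would not imply that [f]
   itself is differentiable: all orders up to 2 are required. *)
Definition C2 (f : R -> R) : Prop :=
  forall theta,
    ex_derive_n f 1 theta /\ ex_derive_n f 2 theta /\
    continuous (Derive_n f 2) theta.

(* C^2 regularity on the circle is expressed in the angular coordinate. *)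
Definition positive_C2_on_circle (u : C -> R) : Prop :=
  (forall z : C, Cmod z = 1 -> 0 < u z) /\ C2 (angular u).

Definition global_minimizer (f : R -> R) (theta0 : R) : Prop :=
  forall theta, f theta0 <= f theta.

(* Gradient for the Euclidean inner product of R^2: [V] is Frechet
   differentiable over the reals at [z], with differential [w |-> <g, w>]. *)
Definition is_gradient (V : C -> R) (z g : C) : Prop :=
  filterdiff (U := C_R_NormedModule) (V := R_NormedModule) V (locally z)
    (fun w : C => Re g * Re w + Im g * Im w).

Definition energy_solution (V : C -> R) (h : R) (x : R -> C) : Prop :=
  exists v a : R -> C, forall t : R,
    x t <> RtoC 0 /\
    is_derive (V := C_R_NormedModule) x t (v t) /\
    is_derive (V := C_R_NormedModule) v t (a t) /\
    is_gradient V (x t) (a t) /\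
    / 2 * (Cmod (v t)) ^ 2 - V (x t) = h.

(* x(t) = sqrt(2h) |t| e^{i theta} + o(|t|) as t tends to [l] *)
Definition asymptotic_direction (x : R -> C) (h theta : R) (l : Rbar) : Prop :=
  is_domin (Kv := R_AbsRing) (V := C_R_NormedModule) (Rbar_locally l)
    (fun t : R => Rabs t)
    (fun t : R => (x t - RtoC (sqrt (2 * h) * Rabs t) * cis theta)%C).

(* Main.v *)
From Stdlib Require Import Lra Lia ZArith Bool Classical ClassicalEpsilon.
Require Import Defs.

(**
Write [x = r e^{i th}], [w = r^2], [p = r r'] and let [J = r^2 th'] be the
angular momentum.  For an [h]-energy solution the Lagrange-Jacobi identity turns
Newton's equation into
  [w' = 2 p],  [p' = 2 h + (2 - alpha) w^{-alpha/2} U(th)],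
  [th' = J / w],  [J' = w^{-alpha/2} U'(th)],
with [p^2 + J^2 = 2 h w + 2 w^{1 - alpha/2} U(th)] ([polar_solution]).  By
homogeneity it is enough to treat [h = 1/2] ([polar_rescale]), and the passage
back to the plane is [polar_energy_solution], which needs the gradient of the
potential in polar coordinates ([is_gradient_potential]).

Since [U > 0] and [alpha <= 2], [p' >= 1]: each solution has a unique point
closest to the origin, its apex, and with time counted from there
[w >= w0 + t^2], where [w0 > 0] is the value at the apex ([parabola_bound]).  So
there is no collision, solutions are global, [J'] and [th'] are integrable over
the line when [alpha >= 3/2], and [th] has limits at both ends.  A solution is
determined, up to the sign of [J], by [w0] and by the angle [th0] at the apex;
only [J > 0] at the apex is considered.  The two limits [Tm] and [Tp] of [th]
depend continuously on the pair [(w0, th0)] ([apex_family]).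

It remains to solve [Tm = theta_minus] and [Tp - Tm = D] for a prescribed
[D > PI].  The solution comes from the Poincare-Miranda theorem in the plane
([poincare_miranda]), whose sign conditions are met on a rectangle.
 - [Tm - th0] is bounded, so [Tm - theta_minus] is negative for small [th0] and
   positive for large [th0].
 - For large [w0] the orbit is nearly a straight line: [J / sqrt w0] is close to
   [1] and the total angle is at most slightly more than the integral
   of [sqrt w0 / (w0 + t^2)], which is [PI] ([half_angle_upper]).
 - For small [w0] the total angle is large if [alpha] is close to [2].  At
   [alpha = 2] one has [w = w0 + t^2] and [J^2 >= 2 min U], so that the total
   angle is at least of order [1 / sqrt w0].  For [alpha] near [2], depending on
   [w0], the bounds on [w] and [J] survive up to constants on a bounded time
   interval [|t| <= T], and beyond it [J] loses too little to change sign
   ([half_angle_lower]).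
The conditions on [alpha] involve only bounds for [U] and [U'], and [D], which
gives [alphabar]; a negative [D] is reached by reversing time.

The solutions starting at an apex are obtained from a globally Lipschitz
truncation of the polar equations, by Picard iteration in a complete normed
module ([flow_derive], [flow_initial_value]); the a priori bounds show that the
truncation is never active ([untruncate]).
*)

(** * Completeness of products *)

Lemma prod_complete_cauchy (V W : CompleteSpace) (F : (V * W -> Prop) -> Prop) :
  ProperFilter F -> cauchy (T := prod_UniformSpace V W) F ->
  forall eps : posreal,
  F (ball (M := prod_UniformSpace V W) (lim (filtermap fst F), lim (filtermap snd F)) eps).
Proof.
  intros HF HC eps.
  apply filter_and.
  - apply (complete_cauchy (filtermap fst F)); [now apply filtermap_proper_filter|].
    intros e; destruct (HC e) as [x Hx]; exists (fst x).
    unfold filtermap; apply filter_imp with (2 := Hx); intros y Hy; apply Hy.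
  - apply (complete_cauchy (filtermap snd F)); [now apply filtermap_proper_filter|].
    intros e; destruct (HC e) as [x Hx]; exists (snd x).
    unfold filtermap; apply filter_imp with (2 := Hx); intros y Hy; apply Hy.
Qed.

Lemma prod_close_lim (V W : CompleteSpace) (F1 F2 : (V * W -> Prop) -> Prop) :
  filter_le F1 F2 -> filter_le F2 F1 ->
  close (M := prod_UniformSpace V W)
    (lim (filtermap fst F1), lim (filtermap snd F1))
    (lim (filtermap fst F2), lim (filtermap snd F2)).
Proof.
  intros H12 H21 eps; split; simpl; apply close_lim; intros P; unfold filtermap;
    (apply H12 || apply H21).
Qed.

(** Phase space is a product of lines, and the flow is built in a complete normed
module, so the product has to be one. *)
Definition prod_CompleteNormedModule (V W : CompleteNormedModule R_AbsRing) :
  CompleteNormedModule R_AbsRing :=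
  CompleteNormedModule.Pack R_AbsRing (V * W)
    (CompleteNormedModule.Class R_AbsRing (V * W)
      (NormedModule.class R_AbsRing (prod_NormedModule R_AbsRing V W))
      (CompleteSpace.Mixin (prod_UniformSpace V W)
        (fun F => (lim (filtermap fst F), lim (filtermap snd F)))
        (prod_complete_cauchy V W) (prod_close_lim V W)))
    (V * W).

(** * The flow of a globally Lipschitz vector field *)

Lemma lipschitz_continuous {V W : NormedModule R_AbsRing} (F : V -> W) (K : R) :
  (forall x y, norm (minus (F x) (F y)) <= K * norm (minus x y)) ->
  forall x, continuous F x.
Proof.
  intros HF x.
  apply filterlim_locally_ball_norm; intros eps.
  assert (HK : 0 < Rabs K + 1) by (pose proof (Rabs_pos K); lra).
  assert (Hd : 0 < eps / (Rabs K + 1)) by (apply Rdiv_lt_0_compat; [apply cond_pos | lra]).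
  apply filter_imp with (2 := locally_ball_norm x (mkposreal _ Hd)).
  unfold ball_norm; simpl; intros y Hy.
  apply Rle_lt_trans with (1 := HF y x).
  apply Rle_lt_trans with ((Rabs K + 1) * norm (minus y x)).
  - apply Rmult_le_compat_r; [apply norm_ge_0 | pose proof (Rle_abs K); lra].
  - apply Rlt_le_trans with ((Rabs K + 1) * (eps / (Rabs K + 1))).
    + apply Rmult_lt_compat_l; lra.
    + right; field; lra.
Qed.

(** The exponential weight absorbs one integration: it makes the Picard map a
contraction on the whole time axis at once, in both time directions. *)
Lemma norm_RInt_exp_le {V : CompleteNormedModule R_AbsRing} (f : R -> V) (c k t : R) :
  0 < k -> (forall s, continuous f s) ->
  (forall s, norm (f s) <= c * k * exp (k * Rabs s)) ->
  norm (RInt f 0 t) <= c * (exp (k * Rabs t) - 1).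
Proof.
  intros Hk Hc Hf.
  assert (Hex : forall a b, ex_RInt f a b)
    by (intros; apply ex_RInt_continuous; intros; apply Hc).
  destruct (Rle_dec 0 t) as [Ht | Ht].
  - rewrite (Rabs_pos_eq t Ht).
    apply (norm_RInt_le f (fun s => c * k * exp (k * s)) 0 t); trivial.
    + intros s Hs; rewrite <- (Rabs_pos_eq s) at 2 by apply Hs; apply Hf.
    + apply RInt_correct, Hex.
    + replace (c * (exp (k * t) - 1))
        with (minus (c * exp (k * t)) (c * exp (k * 0)))
        by (unfold minus, plus, opp; simpl; rewrite Rmult_0_r, exp_0; ring).
      apply (is_RInt_derive (fun s => c * exp (k * s))).
      * intros s _; auto_derive; trivial; ring.
      * intros s _; apply (ex_derive_continuous (fun s => c * k * exp (k * s)));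
          auto_derive; trivial.
  - rewrite <- opp_RInt_swap by apply Hex.
    rewrite (Rabs_left t) by lra.
    apply Rle_trans with (norm (RInt f t 0)); [right; apply (norm_opp (V := V))|].
    apply (norm_RInt_le f (fun s => c * k * exp (- k * s)) t 0); try lra.
    + intros s Hs; replace (- k * s) with (k * Rabs s)
        by (rewrite Rabs_left1; [ring | apply Hs]); apply Hf.
    + apply RInt_correct, Hex.
    + replace (c * (exp (k * - t) - 1))
        with (minus (- c * exp (- k * 0)) (- c * exp (- k * t))).
      2: { unfold minus, plus, opp; simpl.
           rewrite Rmult_0_r, exp_0.
           replace (k * - t) with (- k * t) by ring; ring. }
      apply (is_RInt_derive (fun s => - c * exp (- k * s))).
      * intros s _; auto_derive; trivial; ring.
      * intros s _; apply (ex_derive_continuous (fun s => c * k * exp (- k * s)));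
          auto_derive; trivial.
Qed.

Fixpoint picard {V : CompleteNormedModule R_AbsRing} (F : V -> V) (x0 : V)
  (n : nat) (t : R) : V :=
  match n with
  | O => x0
  | S m => plus x0 (RInt (fun s => F (picard F x0 m s)) 0 t)
  end.

Lemma continuous_primitive {V : CompleteNormedModule R_AbsRing} (f : R -> V) (t : R) :
  (forall s, continuous f s) -> is_derive (fun t => RInt f 0 t) t (f t).
Proof.
  intros Hc.
  apply (is_derive_RInt f (fun t => RInt f 0 t) 0 t); [| apply Hc].
  apply filter_forall; intros b; apply RInt_correct, ex_RInt_continuous; intros; apply Hc.
Qed.

Section Picard.

Context {V : CompleteNormedModule R_AbsRing} (F : V -> V) (K : R).
Hypothesis HK : 0 < K.
Hypothesis HF : forall x y, norm (minus (F x) (F y)) <= K * norm (minus x y).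

Lemma picard_continuous (x0 : V) (n : nat) (t : R) : continuous (picard F x0 n) t.
Proof.
  revert t; induction n as [|n IH]; intros t; simpl.
  - apply continuous_const.
  - apply (continuous_plus (fun _ => x0) (fun t => RInt (fun s => F (picard F x0 n s)) 0 t));
      [apply continuous_const|].
    apply (ex_derive_continuous (V := V)).
    eexists; apply continuous_primitive; intros s.
    apply continuous_comp; [apply IH | apply (lipschitz_continuous F K HF)].
Qed.

Lemma lipschitz_continuous_comp (x : R -> V) :
  (forall t, continuous x t) -> forall t, continuous (fun s => F (x s)) t.
Proof.
  intros Hx t; apply continuous_comp; [apply Hx | apply (lipschitz_continuous F K HF)].
Qed.

Lemma RInt_comp_minus (x y : R -> V) (t : R) :
  (forall t, continuous x t) -> (forall t, continuous y t) ->
  minus (RInt (fun s => F (x s)) 0 t) (RInt (fun s => F (y s)) 0 t) =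
  RInt (fun s => minus (F (x s)) (F (y s))) 0 t.
Proof.
  intros Hx Hy; symmetry; apply (RInt_minus (fun s => F (x s)) (fun s => F (y s)));
    apply ex_RInt_continuous; intros; now apply lipschitz_continuous_comp.
Qed.

Lemma minus_comp_continuous (x y : R -> V) :
  (forall t, continuous x t) -> (forall t, continuous y t) ->
  forall t, continuous (fun s => minus (F (x s)) (F (y s))) t.
Proof.
  intros Hx Hy t.
  apply (continuous_minus (fun s => F (x s)) (fun s => F (y s)));
    now apply lipschitz_continuous_comp.
Qed.

Lemma plus_minus_plus (a b c d : V) :
  minus (plus a b) (plus c d) = plus (minus a c) (minus b d).
Proof.
  unfold minus; rewrite (@opp_plus V), <- !(@plus_assoc V); f_equal.
  rewrite !(@plus_assoc V); f_equal; apply (@plus_comm V).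
Qed.

(** The iterates inherit the Gronwall bound, so that the flow gets it in the limit. *)
(** The iterates satisfy the Gronwall estimate with the constant of the field
itself, so the flow inherits it in the limit. *)
Lemma picard_initial_value (x0 y0 : V) (n : nat) (t : R) :
  norm (minus (picard F x0 n t) (picard F y0 n t)) <=
  norm (minus x0 y0) * exp (K * Rabs t).
Proof.
  revert t; induction n as [|n IH]; intros t.
  - simpl. rewrite <- (Rmult_1_r (norm _)) at 1.
    apply Rmult_le_compat_l; [apply norm_ge_0|].
    rewrite <- exp_0.
    destruct (Req_dec (K * Rabs t) 0) as [->|Hn]; [lra|].
    left; apply exp_increasing.
    pose proof (Rmult_le_pos K (Rabs t) (Rlt_le _ _ HK) (Rabs_pos t)); lra.
  - simpl. rewrite plus_minus_plus, RInt_comp_minus by apply picard_continuous.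
    eapply Rle_trans; [apply (@norm_triangle R_AbsRing V)|].
    pose proof (norm_RInt_exp_le
      (fun s => minus (F (picard F x0 n s)) (F (picard F y0 n s)))
      (norm (minus x0 y0)) K t HK) as H.
    cut (norm (RInt (fun s => minus (F (picard F x0 n s)) (F (picard F y0 n s))) 0 t)
         <= norm (minus x0 y0) * (exp (K * Rabs t) - 1)); [intros; lra|].
    apply H.
    + apply minus_comp_continuous; apply picard_continuous.
    + intros s; apply Rle_trans with (1 := HF _ _).
      rewrite (Rmult_comm (norm _) K), Rmult_assoc.
      apply Rmult_le_compat_l; [lra | apply IH].
Qed.

(** In the weight [exp (2 K |t|)], twice the Lipschitz constant, each iteration
halves the distance between consecutive iterates. *)
Lemma picard_step (x0 : V) (n : nat) (t : R) :
  norm (minus (picard F x0 (S n) t) (picard F x0 n t)) <=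
  norm (F x0) / K * (/ 2) ^ n * exp (2 * K * Rabs t).
Proof.
  assert (H2K : 0 < 2 * K) by lra.
  assert (HM : 0 <= norm (F x0) / K)
    by (apply Rmult_le_pos; [apply norm_ge_0 | left; now apply Rinv_0_lt_compat]).
  assert (He : forall s, 1 <= exp (2 * K * Rabs s)).
  { intros s; rewrite <- exp_0.
    destruct (Req_dec (2 * K * Rabs s) 0) as [->|Hn]; [lra|].
    left; apply exp_increasing.
    pose proof (Rmult_le_pos (2 * K) (Rabs s) (Rlt_le _ _ H2K) (Rabs_pos s)); lra. }
  revert t; induction n as [|n IH]; intros t.
  - simpl.
    replace (minus (plus x0 (RInt (fun _ => F x0) 0 t)) x0) with (RInt (fun _ => F x0) 0 t).
    2: { unfold minus; rewrite (@plus_comm V x0), <- (@plus_assoc V), (@plus_opp_r V), (@plus_zero_r V); easy. }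
    apply Rle_trans with (norm (F x0) / K * (exp (2 * K * Rabs t) - 1)); [| lra].
    apply norm_RInt_exp_le; trivial.
    + intros s; apply continuous_const.
    + intros s. replace (norm (F x0)) with (norm (F x0) / K * K) at 1 by (field; lra).
      pose proof (He s). pose proof (norm_ge_0 (F x0)).
      replace (norm (F x0) / K * (2 * K)) with (2 * norm (F x0)) by (field; lra).
      replace (norm (F x0) / K * K) with (norm (F x0)) by (field; lra).
      nra.
  - change (picard F x0 (S (S n)) t)
      with (plus x0 (RInt (fun s => F (picard F x0 (S n) s)) 0 t)).
    change (picard F x0 (S n) t)
      with (plus x0 (RInt (fun s => F (picard F x0 n s)) 0 t)).
    rewrite plus_minus_plus, RInt_comp_minus by apply picard_continuous.
    rewrite (@minus_eq_zero V x0), (@plus_zero_l V).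
    set (c := norm (F x0) / K * (/ 2) ^ S n).
    assert (Hc : 0 <= c) by (apply Rmult_le_pos; [exact HM | apply pow_le; lra]).
    apply Rle_trans with (c * (exp (2 * K * Rabs t) - 1)); [| lra].
    apply norm_RInt_exp_le; trivial.
    + apply minus_comp_continuous; apply picard_continuous.
    + intros s; apply Rle_trans with (1 := HF _ _).
      apply Rle_trans with (K * (norm (F x0) / K * (/ 2) ^ n * exp (2 * K * Rabs s))).
      * apply Rmult_le_compat_l; [lra | apply IH].
      * right; unfold c; simpl; field; lra.
Qed.

Lemma picard_cauchy (x0 : V) (n m : nat) (t : R) :
  norm (minus (picard F x0 (n + m) t) (picard F x0 n t)) <=
  2 * (norm (F x0) / K) * (/ 2) ^ n * exp (2 * K * Rabs t).
Proof.
  set (M := norm (F x0) / K).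
  assert (HM : 0 <= M)
    by (apply Rmult_le_pos; [apply norm_ge_0 | left; now apply Rinv_0_lt_compat]).
  set (E := exp (2 * K * Rabs t)).
  assert (HE : 0 < E) by apply exp_pos.
  assert (H : norm (minus (picard F x0 (n + m) t) (picard F x0 n t)) <=
    M * E * (2 * (/ 2) ^ n - 2 * (/ 2) ^ (n + m))).
  { induction m as [|m IH].
    - rewrite Nat.add_0_r, (@minus_eq_zero V).
      apply Rle_trans with 0; [right; apply (@norm_zero R_AbsRing V) | lra].
    - rewrite Nat.add_succ_r.
      rewrite (@minus_trans V (picard F x0 (n + m) t)).
      eapply Rle_trans; [apply (@norm_triangle R_AbsRing V)|].
      pose proof (picard_step x0 (n + m) t) as Hs. fold M E in Hs.
      simpl ((/ 2) ^ S (n + m)).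
      eapply Rle_trans; [apply Rplus_le_compat; [exact Hs | exact IH] | right; field]. }
  apply Rle_trans with (1 := H).
  assert (0 < (/ 2) ^ (n + m)) by (apply pow_lt; lra).
  pose proof (Rmult_le_pos M E HM (Rlt_le _ _ HE)). nra.
Qed.

Definition flow (x0 : V) (t : R) : V :=
  lim (filtermap (fun n => picard F x0 n t) eventually).

Lemma geometric_eventually_lt (c eps : R) :
  0 < eps -> exists N, forall n, (N <= n)%nat -> c * (/ 2) ^ n < eps.
Proof.
  intros He.
  assert (Hc : 0 < Rabs c + 1) by (pose proof (Rabs_pos c); lra).
  destruct (pow_lt_1_zero (/ 2) ltac:(rewrite Rabs_pos_eq; lra)
    (eps / (Rabs c + 1)) ltac:(now apply Rdiv_lt_0_compat)) as [N HN].
  exists N; intros n Hn; specialize (HN n Hn).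
  assert (Hp : 0 < (/ 2) ^ n) by (apply pow_lt; lra).
  rewrite Rabs_pos_eq in HN by lra.
  apply Rle_lt_trans with ((Rabs c + 1) * (/ 2) ^ n).
  - apply Rmult_le_compat_r; [lra | pose proof (Rle_abs c); lra].
  - replace eps with ((Rabs c + 1) * (eps / (Rabs c + 1))) by (field; lra).
    apply Rmult_lt_compat_l; trivial.
Qed.

Lemma norm_minus_sym (a b : V) : norm (minus a b) = norm (minus b a).
Proof. rewrite <- (@opp_minus V). apply (@norm_opp R_AbsRing V). Qed.

Lemma norm_minus_triangle (b a c : V) :
  norm (minus a c) <= norm (minus a b) + norm (minus b c).
Proof. rewrite (@minus_trans V b a c). apply (@norm_triangle R_AbsRing V). Qed.

Lemma picard_converges (x0 : V) (t : R) :
  filterlim (fun n => picard F x0 n t) eventually (locally (flow x0 t)).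
Proof.
  apply filterlim_locally; intros eps.
  apply (complete_cauchy (filtermap (fun n => picard F x0 n t) eventually)).
  - apply filtermap_proper_filter, eventually_filter.
  - intros e.
    destruct (geometric_eventually_lt
      (2 * (norm (F x0) / K) * exp (2 * K * Rabs t)) e (cond_pos e)) as [N HN].
    exists (picard F x0 N t), N; intros n Hn.
    apply (@norm_compat1 R_AbsRing V).
    replace n with (N + (n - N))%nat by lia.
    eapply Rle_lt_trans; [apply picard_cauchy|].
    specialize (HN N (Nat.le_refl _)); lra.
Qed.

Lemma picard_converges_norm (x0 : V) (t eps : R) : 0 < eps ->
  exists N, forall n, (N <= n)%nat -> norm (minus (picard F x0 n t) (flow x0 t)) < eps.
Proof.
  intros He.
  destruct (proj1 (filterlim_locally_ball_norm _ _)
    (picard_converges x0 t) (mkposreal eps He)) as [N HN].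
  exists N; intros n Hn; exact (HN n Hn).
Qed.

(** Continuity is used below only through the norm. *)
Lemma continuous_norm_iff (f : R -> V) (t : R) :
  continuous f t <->
  forall eps, 0 < eps -> locally t (fun s => norm (minus (f s) (f t)) < eps).
Proof.
  split; intros H.
  - intros eps He.
    exact (proj1 (filterlim_locally_ball_norm _ _) H (mkposreal eps He)).
  - apply (filterlim_locally_ball_norm (U := V) f (f t)); intros eps.
    exact (H eps (cond_pos eps)).
Qed.

Lemma picard_error (x0 : V) (n : nat) (t : R) :
  norm (minus (flow x0 t) (picard F x0 n t)) <=
  2 * (norm (F x0) / K) * exp (2 * K * Rabs t) * (/ 2) ^ n.
Proof.
  apply le_epsilon; intros eps He.
  destruct (picard_converges_norm x0 t eps He) as [N HN].
  specialize (HN (n + N)%nat ltac:(lia)).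
  apply Rle_trans with (1 := norm_minus_triangle (picard F x0 (n + N) t) _ _).
  rewrite (norm_minus_sym (flow x0 t)).
  pose proof (picard_cauchy x0 n N t); lra.
Qed.

Lemma flow_continuous (x0 : V) (t : R) : continuous (flow x0) t.
Proof.
  apply continuous_norm_iff; intros eps Heps.
  (* [c] is the constant of [picard_error] for all times within distance [1] of
     [t]. *)
  set (c := 2 * (norm (F x0) / K) * exp (2 * K * (Rabs t + 1))).
  destruct (geometric_eventually_lt c (eps / 3)
    ltac:(lra)) as [N HN].
  specialize (HN N (Nat.le_refl _)).
  assert (Hc : forall s, Rabs s <= Rabs t + 1 ->
    norm (minus (flow x0 s) (picard F x0 N s)) < eps / 3).
  { intros s Hs; eapply Rle_lt_trans; [apply picard_error|].
    apply Rle_lt_trans with (2 := HN).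
    apply Rmult_le_compat_r; [apply pow_le; lra|].
    apply Rmult_le_compat_l.
    - apply Rmult_le_pos; [lra|].
      apply Rmult_le_pos; [apply norm_ge_0 | left; now apply Rinv_0_lt_compat].
    - destruct (Req_dec (Rabs s) (Rabs t + 1)) as [->|Hn]; [lra|].
      left; apply exp_increasing, Rmult_lt_compat_l; lra. }
  pose proof (proj1 (continuous_norm_iff _ _) (picard_continuous x0 N t)
    (eps / 3) ltac:(lra)) as H.
  assert (Hl : locally t (fun s => Rabs s <= Rabs t + 1)).
  { exists (mkposreal 1 Rlt_0_1); intros s Hs; simpl in s.
    change (Rabs (minus s t) < 1) in Hs; unfold minus, plus, opp in Hs; simpl in Hs; change (Rabs (s + - t) < 1) in Hs.
    pose proof (Rabs_triang t (s + - t)) as Ht.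
    replace (t + (s + - t)) with (s : R) in Ht by (simpl; ring); lra. }
  generalize (filter_and _ _ H Hl); apply filter_imp.
  intros s [Hs1 Hs2].
  apply Rle_lt_trans with (1 := norm_minus_triangle (picard F x0 N s) _ _).
  pose proof (norm_minus_triangle (picard F x0 N t) (picard F x0 N s) (flow x0 t)) as H3.
  rewrite (norm_minus_sym (picard F x0 N t) (flow x0 t)) in H3.
  pose proof (Hc s Hs2); pose proof (Hc t ltac:(lra)); lra.
Qed.

(** Both sides are limits of the same iterates, uniformly on bounded times, so their
distance is below every positive number. *)
Lemma flow_integral (x0 : V) (t : R) :
  flow x0 t = plus x0 (RInt (fun s => F (flow x0 s)) 0 t).
Proof.
  destruct (classic (flow x0 t = plus x0 (RInt (fun s => F (flow x0 s)) 0 t)))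
    as [H|H]; trivial; exfalso.
  pose proof (@norm_minus_gt_0 R_AbsRing V _ _ H) as Hp.
  set (d := norm _) in Hp.
  set (E := exp (2 * K * Rabs t)).
  set (M := norm (F x0) / K).
  destruct (geometric_eventually_lt (2 * (2 * M * E)) d Hp) as [N HN].
  specialize (HN N (Nat.le_refl _)).
  assert (Hd : d <= 2 * M * E * (/ 2) ^ (S N) + 2 * M * (/ 2) ^ N * (E - 1)).
  { unfold d.
    apply Rle_trans with (1 := norm_minus_triangle (picard F x0 (S N) t) _ _).
    apply Rplus_le_compat; [apply picard_error|].
    simpl picard. rewrite plus_minus_plus, (@minus_eq_zero V x0), (@plus_zero_l V).
    rewrite RInt_comp_minus by (apply picard_continuous || apply flow_continuous).
    apply norm_RInt_exp_le; [lra| |].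
    - apply minus_comp_continuous; [apply picard_continuous | apply flow_continuous].
    - intros s; apply Rle_trans with (1 := HF _ _).
      rewrite norm_minus_sym.
      apply Rle_trans with (K * (2 * M * exp (2 * K * Rabs s) * (/ 2) ^ N)).
      + apply Rmult_le_compat_l; [lra | apply picard_error].
      + assert (HM : 0 <= M)
          by (apply Rmult_le_pos; [apply norm_ge_0 | left; now apply Rinv_0_lt_compat]).
        assert (Hq : 0 <= M * exp (2 * K * Rabs s) * (/ 2) ^ N).
        { apply Rmult_le_pos; [apply Rmult_le_pos; [exact HM | left; apply exp_pos]|].
          apply pow_le; lra. }
        nra. }
  assert (HM : 0 <= M)
    by (apply Rmult_le_pos; [apply norm_ge_0 | left; now apply Rinv_0_lt_compat]).
  assert (HE : 0 < E) by apply exp_pos.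
  assert (Hq : 0 < (/ 2) ^ N) by (apply pow_lt; lra).
  simpl pow in Hd. pose proof (Rmult_le_pos M _ HM (Rlt_le _ _ Hq)).
  pose proof (Rmult_le_pos (M * (/ 2) ^ N) E ltac:(lra) ltac:(lra)). nra.
Qed.

Lemma flow_derive (x0 : V) (t : R) : is_derive (flow x0) t (F (flow x0 t)).
Proof.
  apply is_derive_ext with (fun t => plus x0 (RInt (fun s => F (flow x0 s)) 0 t)).
  - intros s; symmetry; apply flow_integral.
  - rewrite <- (@plus_zero_l V (F (flow x0 t))).
    apply (@is_derive_plus R_AbsRing V (fun _ => x0)); [apply @is_derive_const|].
    apply (continuous_primitive (fun s => F (flow x0 s))).
    apply lipschitz_continuous_comp, flow_continuous.
Qed.

Lemma flow_0 (x0 : V) : flow x0 0 = x0.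
Proof.
  rewrite flow_integral, RInt_point. apply (@plus_zero_r V).
Qed.

Lemma flow_initial_value (x0 y0 : V) (t : R) :
  norm (minus (flow x0 t) (flow y0 t)) <= norm (minus x0 y0) * exp (K * Rabs t).
Proof.
  apply le_epsilon; intros eps He.
  destruct (picard_converges_norm x0 t (eps / 2) ltac:(lra)) as [N HN].
  destruct (picard_converges_norm y0 t (eps / 2) ltac:(lra)) as [N' HN'].
  specialize (HN (N + N')%nat ltac:(lia)); specialize (HN' (N + N')%nat ltac:(lia)).
  apply Rle_trans with (1 := norm_minus_triangle (picard F x0 (N + N') t) _ _).
  rewrite (norm_minus_sym (flow x0 t) (picard F x0 (N + N') t)).
  pose proof (norm_minus_triangle (picard F y0 (N + N') t)
    (picard F x0 (N + N') t) (flow y0 t)).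
  pose proof (picard_initial_value x0 y0 (N + N') t); lra.
Qed.

End Picard.

(** * The Poincare-Miranda theorem in the plane *)

(** Sums modulo 2, for the parity count of edges. *)
Fixpoint xorsum (f : nat -> bool) (n : nat) : bool :=
  match n with O => false | S m => xorb (xorsum f m) (f m) end.

Lemma xorsum_telescope (f : nat -> bool) (n : nat) :
  xorsum (fun i => xorb (f i) (f (S i))) n = xorb (f O) (f n).
Proof.
  induction n as [|n IH]; simpl; [now rewrite xorb_nilpotent|].
  rewrite IH. destruct (f O), (f n), (f (S n)); reflexivity.
Qed.

Lemma xorsum_xorb (f g : nat -> bool) (n : nat) :
  xorsum (fun i => xorb (f i) (g i)) n = xorb (xorsum f n) (xorsum g n).
Proof.
  induction n as [|n IH]; simpl; trivial.
  rewrite IH. destruct (xorsum f n), (xorsum g n), (f n), (g n); reflexivity.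
Qed.

Lemma xorsum_ext (f g : nat -> bool) (n : nat) :
  (forall i, (i < n)%nat -> f i = g i) -> xorsum f n = xorsum g n.
Proof.
  induction n as [|n IH]; intros H; simpl; trivial.
  rewrite IH, H; trivial; [lia|]. intros; apply H; lia.
Qed.

Lemma xorsum_false (n : nat) : xorsum (fun _ => false) n = false.
Proof. induction n as [|n IH]; simpl; [|rewrite IH]; reflexivity. Qed.

Definition nonconstant_on_cell (a : nat -> nat -> bool) (i j : nat) : Prop :=
  exists i1 j1 i2 j2,
    (i <= i1 <= S i)%nat /\ (i <= i2 <= S i)%nat /\
    (j <= j1 <= S j)%nat /\ (j <= j2 <= S j)%nat /\
    a i1 j1 = true /\ a i2 j2 = false.

(** An edge of the grid is marked when [a] holds at both ends while [b] changes.  In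
the language of Sperner labels ([0] where [a] fails, otherwise [1] or [2]
according to [b]) these are the edges with labels [1] and [2]. *)
Definition marked_edge (a1 b1 a2 b2 : bool) : bool := a1 && a2 && xorb b1 b2.

(** A triangle with an odd number of marked edges carries all three Sperner labels:
both [a] and [b] change on it. *)
Lemma marked_triangle (a1 b1 a2 b2 a3 b3 : bool) :
  xorb (marked_edge a1 b1 a2 b2)
    (xorb (marked_edge a2 b2 a3 b3) (marked_edge a3 b3 a1 b1)) = true ->
  (a1 || a2 || a3) && negb (a1 && a2 && a3) && (b1 || b2 || b3) && negb (b1 && b2 && b3) = true.
Proof.
  destruct a1, b1, a2, b2, a3, b3; cbv; intros; reflexivity || discriminate.
Qed.

(** Sperner's parity argument.  Cut each cell by a diagonal.  If no cell had both
properties, every triangle would have an even number of marked edges; then the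
number of marked edges on a vertical grid line would have constant parity from
one line to the next, the horizontal sides of the square carrying no mark.  But
it is [0] on the left side, and on the right side, where [b] goes from false to
true, it is odd. *)
Lemma grid_miranda (a b : nat -> nat -> bool) (n : nat) :
  (0 < n)%nat ->
  (forall j, (j <= n)%nat -> a O j = false /\ a n j = true) ->
  (forall i, (i <= n)%nat -> b i O = false /\ b i n = true) ->
  exists i j, (i < n)%nat /\ (j < n)%nat /\
    nonconstant_on_cell a i j /\ nonconstant_on_cell b i j.
Proof.
  intros Hn Ha Hb.
  destruct (classic (exists i j, (i < n)%nat /\ (j < n)%nat /\
    nonconstant_on_cell a i j /\ nonconstant_on_cell b i j)) as [H|H]; trivial; exfalso.
  set (hor := fun i j => marked_edge (a i j) (b i j) (a (S i) j) (b (S i) j)).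
  set (ver := fun i j => marked_edge (a i j) (b i j) (a i (S j)) (b i (S j))).
  assert (Htri : forall i j i1 j1 i2 j2 i3 j3, (i < n)%nat -> (j < n)%nat ->
    (i <= i1 <= S i)%nat -> (i <= i2 <= S i)%nat -> (i <= i3 <= S i)%nat ->
    (j <= j1 <= S j)%nat -> (j <= j2 <= S j)%nat -> (j <= j3 <= S j)%nat ->
    xorb (marked_edge (a i1 j1) (b i1 j1) (a i2 j2) (b i2 j2))
      (xorb (marked_edge (a i2 j2) (b i2 j2) (a i3 j3) (b i3 j3))
        (marked_edge (a i3 j3) (b i3 j3) (a i1 j1) (b i1 j1))) = false).
  { intros i j i1 j1 i2 j2 i3 j3 Hi Hj H1 H2 H3 K1 K2 K3.
    apply not_true_iff_false; intros Ht; apply H; exists i, j.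
    apply marked_triangle in Ht.
    rewrite !andb_true_iff, !orb_true_iff, !negb_true_iff, !andb_false_iff in Ht.
    destruct Ht as [[[Hat Haf] Hbt] Hbf].
    repeat split; trivial.
    - destruct Hat as [[E|E]|E]; destruct Haf as [[E'|E']|E'];
        try congruence; unfold nonconstant_on_cell;
        do 4 eexists; (split; [|split; [|split; [|split; [|split; [exact E | exact E']]]]]; trivial).
    - destruct Hbt as [[E|E]|E]; destruct Hbf as [[E'|E']|E'];
        try congruence; unfold nonconstant_on_cell;
        do 4 eexists; (split; [|split; [|split; [|split; [|split; [exact E | exact E']]]]]; trivial). }
  (* The diagonal is common to the two triangles and cancels. *)
  assert (Hcell : forall i j, (i < n)%nat -> (j < n)%nat ->
    ver (S i) j = xorb (ver i j) (xorb (hor i j) (hor i (S j)))).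
  { intros i j Hi Hj.
    pose proof (Htri i j i j (S i) j (S i) (S j) Hi Hj) as H1.
    pose proof (Htri i j i j i (S j) (S i) (S j) Hi Hj) as H2.
    specialize (H1 ltac:(lia) ltac:(lia) ltac:(lia) ltac:(lia) ltac:(lia) ltac:(lia)).
    specialize (H2 ltac:(lia) ltac:(lia) ltac:(lia) ltac:(lia) ltac:(lia) ltac:(lia)).
    unfold hor, ver.
    revert H1 H2.
    destruct (a i j), (a (S i) j), (a i (S j)), (a (S i) (S j)),
      (b i j), (b (S i) j), (b i (S j)), (b (S i) (S j));
      cbv; intros; reflexivity || discriminate. }
  assert (Hcol : forall i, (i <= n)%nat -> xorsum (ver i) n = false).
  { induction i as [|i IH]; intros Hi.
    - rewrite <- (xorsum_false n); apply xorsum_ext; intros j Hj.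
      unfold ver, marked_edge; now rewrite (proj1 (Ha j ltac:(lia))).
    - rewrite (xorsum_ext _ (fun j => xorb (ver i j) (xorb (hor i j) (hor i (S j)))))
        by (intros j Hj; apply Hcell; lia).
      rewrite xorsum_xorb, xorsum_telescope, IH by lia.
      unfold hor, marked_edge.
      destruct (Hb i ltac:(lia)) as [-> ->], (Hb (S i) ltac:(lia)) as [-> ->].
      simpl; now rewrite !andb_false_r. }
  specialize (Hcol n (Nat.le_refl _)).
  rewrite (xorsum_ext _ (fun j => xorb (b n j) (b n (S j)))), xorsum_telescope in Hcol.
  - destruct (Hb n (Nat.le_refl _)) as [E1 E2]; rewrite E1, E2 in Hcol; discriminate.
  - intros j Hj; unfold ver, marked_edge.
    rewrite (proj2 (Ha j ltac:(lia))), (proj2 (Ha (S j) ltac:(lia))); reflexivity.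
Qed.

Definition continuous2_at (f : R -> R -> R) (x y : R) : Prop :=
  forall eps, 0 < eps -> exists delta, 0 < delta /\
    forall x' y', Rabs (x' - x) < delta -> Rabs (y' - y) < delta ->
      Rabs (f x' y' - f x y) < eps.

Lemma nonzero_near (f : R -> R -> R) (x y : R) :
  continuous2_at f x y -> f x y <> 0 -> exists delta, 0 < delta /\
    forall x1 y1 x2 y2, Rabs (x1 - x) < delta -> Rabs (y1 - y) < delta ->
      Rabs (x2 - x) < delta -> Rabs (y2 - y) < delta -> 0 < f x1 y1 * f x2 y2.
Proof.
  intros Hc Hf. destruct (Hc (Rabs (f x y)) (Rabs_pos_lt _ Hf)) as [d [Hd H]].
  exists d; split; trivial; intros x1 y1 x2 y2 H1 H2 H3 H4.
  specialize (H x1 y1 H1 H2) as E1; specialize (H x2 y2 H3 H4) as E2.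
  apply Rabs_def2 in E1; apply Rabs_def2 in E2.
  destruct (Rdichotomy _ _ Hf) as [Hn|Hp].
  - rewrite (Rabs_left (f x y)) in E1, E2 by lra.
    assert (f x1 y1 < 0) by lra; assert (f x2 y2 < 0) by lra; nra.
  - rewrite (Rabs_pos_eq (f x y)) in E1, E2 by lra.
    apply Rmult_lt_0_compat; lra.
Qed.

(** If there were no common zero, each point would have a neighbourhood on which [f]
or [g] keeps a strict sign.  By compactness one grid step fits all these
neighbourhoods, against the cell on which both signs change. *)
Lemma poincare_miranda (f g : R -> R -> R) (x0 x1 y0 y1 : R) :
  x0 < x1 -> y0 < y1 ->
  (forall x y, x0 <= x <= x1 -> y0 <= y <= y1 ->
    continuous2_at f x y /\ continuous2_at g x y) ->
  (forall y, y0 <= y <= y1 -> f x0 y < 0 < f x1 y) ->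
  (forall x, x0 <= x <= x1 -> g x y0 < 0 < g x y1) ->
  exists x y, x0 <= x <= x1 /\ y0 <= y <= y1 /\ f x y = 0 /\ g x y = 0.
Proof.
  intros Hx Hy Hc Hf Hg.
  destruct (classic (exists x y, x0 <= x <= x1 /\ y0 <= y <= y1 /\ f x y = 0 /\ g x y = 0))
    as [H|H]; trivial; exfalso.
  (* The factor [2] leaves room for a cell of size [d] whose corner is within [d]
     of the centre. *)
  set (good := fun (h : R -> R -> R) x y d =>
    forall xa ya xb yb, Rabs (xa - x) < 2 * d -> Rabs (ya - y) < 2 * d ->
      Rabs (xb - x) < 2 * d -> Rabs (yb - y) < 2 * d -> 0 < h xa ya * h xb yb).
  assert (Hgood : forall x y, exists d : posreal,
    x0 <= x <= x1 -> y0 <= y <= y1 -> good f x y d \/ good g x y d).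
  { intros x y.
    destruct (classic (x0 <= x <= x1 /\ y0 <= y <= y1)) as [[Bx By]|B];
      [| exists (mkposreal 1 Rlt_0_1); intros; exfalso; tauto].
    destruct (Hc x y Bx By) as [Cf Cg].
    assert (Hex : forall h, continuous2_at h x y -> h x y <> 0 ->
      exists d : posreal, good h x y d).
    { intros h Ch Nh. destruct (nonzero_near h x y Ch Nh) as [d [Hd Hs]].
      assert (Hd2 : 0 < d / 2) by lra.
      exists (mkposreal _ Hd2); intros xa ya xb yb; simpl; intros.
      apply Hs; lra. }
    destruct (Req_dec (f x y) 0) as [Ef|Nf].
    - assert (Ng : g x y <> 0) by (intros Eg; apply H; exists x, y; tauto).
      destruct (Hex g Cg Ng) as [d Hd]; exists d; tauto.
    - destruct (Hex f Cf Nf) as [d Hd]; exists d; tauto. }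
  set (delta := fun x y => proj1_sig (constructive_indefinite_description _ (Hgood x y))).
  assert (Hdelta : forall x y, x0 <= x <= x1 -> y0 <= y <= y1 ->
    good f x y (delta x y) \/ good g x y (delta x y))
    by (intros x y; unfold delta; destruct constructive_indefinite_description; trivial).
  destruct (compactness_value_2d x0 x1 y0 y1 delta) as [d Hd].
  set (m := Rmax (x1 - x0) (y1 - y0)).
  assert (Hm : 0 < m) by (apply Rlt_le_trans with (2 := Rmax_l _ _); lra).
  destruct (archimed_cor1 (d / m)) as [n [Hn1 Hn]];
    [apply Rdiv_lt_0_compat; [apply cond_pos | trivial]|].
  assert (HnR : 0 < INR n) by (apply lt_0_INR; trivial).
  assert (Hstep : m * / INR n < d).
  { apply Rlt_le_trans with (m * (d / m)); [now apply Rmult_lt_compat_l|].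
    right; field; lra. }
  set (px := fun i => x0 + INR i * ((x1 - x0) * / INR n)).
  set (py := fun j => y0 + INR j * ((y1 - y0) * / INR n)).
  assert (Hin : 0 < / INR n) by now apply Rinv_0_lt_compat.
  assert (Hsx : 0 < (x1 - x0) * / INR n < d).
  { split; [apply Rmult_lt_0_compat; lra|].
    apply Rle_lt_trans with (2 := Hstep); apply Rmult_le_compat_r; [lra | apply Rmax_l]. }
  assert (Hsy : 0 < (y1 - y0) * / INR n < d).
  { split; [apply Rmult_lt_0_compat; lra|].
    apply Rle_lt_trans with (2 := Hstep); apply Rmult_le_compat_r; [lra | apply Rmax_r]. }
  assert (Hpx : forall i, (i <= n)%nat -> x0 <= px i <= x1).
  { intros i Hi; apply le_INR in Hi; pose proof (pos_INR i).
    assert (px n = x1) by (unfold px; field; lra).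
    unfold px in *; split; [nra|]. nra. }
  assert (Hpy : forall j, (j <= n)%nat -> y0 <= py j <= y1).
  { intros i Hi; apply le_INR in Hi; pose proof (pos_INR i).
    assert (py n = y1) by (unfold py; field; lra).
    unfold py in *; split; [nra|]. nra. }
  assert (Hnear : forall i k, (i <= k <= S i)%nat ->
    Rabs (px k - px i) < d /\ Rabs (py k - py i) < d).
  { intros i k Hk.
    assert (Ek : k = i \/ k = S i) by lia.
    destruct Ek as [->| ->].
    - rewrite !Rminus_diag, Rabs_R0; split; apply cond_pos.
    - unfold px, py; rewrite S_INR.
      split; [replace (_ - _) with ((x1 - x0) * / INR n) by ring
             |replace (_ - _) with ((y1 - y0) * / INR n) by ring];
        rewrite Rabs_pos_eq; lra. }
  set (pos := fun (h : R -> R -> R) i j => if Rlt_dec 0 (h (px i) (py j)) then true else false).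
  assert (Hpos : forall h i j, pos h i j = true -> 0 < h (px i) (py j))
    by (intros h i j; unfold pos; destruct Rlt_dec; [trivial | discriminate]).
  assert (Hneg : forall h i j, pos h i j = false -> h (px i) (py j) <= 0)
    by (intros h i j; unfold pos; destruct Rlt_dec; [discriminate | lra]).
  assert (E0x : px O = x0) by (unfold px; simpl; ring).
  assert (Enx : px n = x1) by (unfold px; field; lra).
  assert (E0y : py O = y0) by (unfold py; simpl; ring).
  assert (Eny : py n = y1) by (unfold py; field; lra).
  destruct (grid_miranda (pos f) (pos g) n Hn) as [i [j [Hi [Hj [Nf Ng]]]]].
  - intros j Hj; specialize (Hf (py j) (Hpy j Hj)).
    unfold pos; rewrite E0x, Enx.
    split; destruct Rlt_dec; lra || trivial.
  - intros i Hi; specialize (Hg (px i) (Hpx i Hi)).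
    unfold pos; rewrite E0y, Eny.
    split; destruct Rlt_dec; lra || trivial.
  - apply (Hd (px i) (py j)); [apply Hpx; lia | apply Hpy; lia |].
    intros [u [v [Bu [Bv [Du [Dv Dd]]]]]].
    assert (Hcell : forall i' j', (i <= i' <= S i)%nat -> (j <= j' <= S j)%nat ->
      Rabs (px i' - u) < 2 * delta u v /\ Rabs (py j' - v) < 2 * delta u v).
    { intros i' j' Hi' Hj'.
      pose proof (proj1 (Hnear i i' Hi')); pose proof (proj2 (Hnear j j' Hj')).
      pose proof (Rabs_triang (px i' - px i) (px i - u)).
      pose proof (Rabs_triang (py j' - py j) (py j - v)).
      replace (px i' - u) with (px i' - px i + (px i - u)) by ring.
      replace (py j' - v) with (py j' - py j + (py j - v)) by ring.
      lra. }
    assert (Hno : forall h, nonconstant_on_cell (pos h) i j -> ~ good h u v (delta u v)).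
    { intros h [i1 [j1 [i2 [j2 [H1 [H2 [H3 [H4 [E1 E2]]]]]]]]] Hgd.
      destruct (Hcell i1 j1 H1 H3) as [A1 A2], (Hcell i2 j2 H2 H4) as [A3 A4].
      specialize (Hgd _ _ _ _ A1 A2 A3 A4).
      apply Hpos in E1; apply Hneg in E2; nra. }
    destruct (Hdelta u v Bu Bv) as [G|G]; [apply (Hno f Nf G) | apply (Hno g Ng G)].
Qed.

(** * Gradients in polar coordinates *)

Lemma is_gradient_ext_loc (f g : C -> R) (z d : C) :
  locally (T := C_R_NormedModule) z (fun y => f y = g y) ->
  is_gradient f z d -> is_gradient g z d.
Proof.
  intros He Hf.
  now apply (filterdiff_ext_locally (K := R_AbsRing) (U := C_R_NormedModule) (V := R_NormedModule) f g).
Qed.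

(** Together with sums, products and linear forms, this chain rule computes the
gradient of the potential. *)
Lemma is_gradient_comp (f : C -> R) (g : R -> R) (z : C) (a b d : R) :
  is_gradient f z (a, b) -> is_derive g (f z) d ->
  is_gradient (fun y => g (f y)) z (d * a, d * b).
Proof.
  intros Hf Hg.
  apply (filterdiff_ext_lin (U := C_R_NormedModule) (V := R_NormedModule) _
    (fun w => scal ((fun w => Re (a, b) * Re w + Im (a, b) * Im w) w) d)).
  - apply (filterdiff_comp' (U := C_R_NormedModule) (V := R_NormedModule)
      (W := R_NormedModule) f g z _ (fun y => scal y d)); assumption.
  - intros w; simpl; unfold scal; simpl; unfold mult; simpl; ring.
Qed.

Lemma is_gradient_plus (f g : C -> R) (z : C) (a b a' b' : R) :
  is_gradient f z (a, b) -> is_gradient g z (a', b') ->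
  is_gradient (fun y => f y + g y) z (a + a', b + b').
Proof.
  intros Hf Hg.
  apply (filterdiff_ext_lin (U := C_R_NormedModule) (V := R_NormedModule) _
    (fun w => plus (Re (a, b) * Re w + Im (a, b) * Im w)
                   (Re (a', b') * Re w + Im (a', b') * Im w))).
  - apply (filterdiff_plus_fct (U := C_R_NormedModule) (V := R_NormedModule) f g);
      assumption.
  - intros w; simpl; unfold plus; simpl; ring.
Qed.

Lemma is_gradient_mult (f g : C -> R) (z : C) (a b a' b' : R) :
  is_gradient f z (a, b) -> is_gradient g z (a', b') ->
  is_gradient (fun y => f y * g y) z (a * g z + f z * a', b * g z + f z * b').
Proof.
  intros Hf Hg.
  eapply (filterdiff_ext_lin (U := C_R_NormedModule) (V := R_NormedModule)).
  - apply (filterdiff_mult_fct (K := R_AbsRing) (U := C_R_NormedModule) f g);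
      [apply Rmult_comm | exact Hf | exact Hg].
  - intros w; simpl; unfold plus, mult; simpl; ring.
Qed.

Lemma is_gradient_linear (a b : R) (z : C) :
  is_gradient (fun y => a * Re y + b * Im y) z (a, b).
Proof.
  apply (filterdiff_linear (U := C_R_NormedModule) (V := R_NormedModule)
    (fun y => a * Re y + b * Im y)).
  apply (is_linear_comp (K := R_AbsRing) (U := C_R_NormedModule) (V := prod_NormedModule R_AbsRing R_NormedModule R_NormedModule) (W := R_NormedModule)
    (fun y : C => (a * Re y, b * Im y)) (fun p => plus (fst p) (snd p))).
  - apply (is_linear_prod (K := R_AbsRing) (T := C_R_NormedModule) (U := R_NormedModule)
      (V := R_NormedModule) (fun y => a * Re y) (fun y => b * Im y)).
    + apply (is_linear_comp (K := R_AbsRing) (U := C_R_NormedModule) (V := R_NormedModule)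
        (W := R_NormedModule) Re (fun y => a * y)).
      * apply (is_linear_fst (K := R_AbsRing) (U := R_NormedModule) (V := R_NormedModule)).
      * apply (is_linear_scal_r (V := R_NormedModule) a). exact Rmult_comm.
    + apply (is_linear_comp (K := R_AbsRing) (U := C_R_NormedModule) (V := R_NormedModule)
        (W := R_NormedModule) Im (fun y => b * y)).
      * apply (is_linear_snd (K := R_AbsRing) (U := R_NormedModule) (V := R_NormedModule)).
      * apply (is_linear_scal_r (V := R_NormedModule) b). exact Rmult_comm.
  - apply (is_linear_plus (K := R_AbsRing) (V := R_NormedModule)).
Qed.

Lemma is_gradient_eq (f : C -> R) (z d d' : C) :
  is_gradient f z d -> d = d' -> is_gradient f z d'.
Proof. now intros H <-. Qed.

Lemma is_derive_C (f g : R -> R) (t a b : R) :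
  is_derive f t a -> is_derive g t b ->
  is_derive (V := C_R_NormedModule) (fun s => (f s, g s) : C) t (a, b).
Proof.
  intros Hf Hg.
  apply (filterdiff_comp_2 (T := R_NormedModule) (U := R_NormedModule)
    (V := R_NormedModule) (W := C_R_NormedModule) f g (fun x y => (x, y) : C)
    (fun y => scal y a) (fun y => scal y b) (fun x y => (x, y) : C)); trivial.
  apply filterdiff_ext with (fun p => p); [now intros []|].
  apply filterdiff_ext_lin with (fun p => p); [apply filterdiff_id | now intros []].
Qed.

Lemma Cmod_cis (theta : R) : Cmod (cis theta) = 1.
Proof.
  unfold Cmod, cis; simpl. rewrite !Rmult_1_r.
  pose proof (sin2_cos2 theta) as H; unfold Rsqr in H.
  rewrite Rplus_comm, H; apply sqrt_1.
Qed.

Lemma locally_is_gradient_pos (f : C -> R) (z d : C) :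
  is_gradient f z d -> 0 < f z ->
  locally (T := C_R_NormedModule) z (fun y => 0 < f y).
Proof.
  intros Hf Hz.
  assert (Hc : continuous (T := C_R_NormedModule) (U := R_NormedModule) f z)
    by (apply filterdiff_continuous; eexists; exact Hf).
  apply (Hc (fun y => 0 < y)).
  now apply (open_gt 0).
Qed.

(** A local branch of the argument around the direction [theta]: in the frame
rotated by [theta] the point has coordinates [l1 > 0] and [l2], and its angle
exceeds [theta] by [atan (l2 / l1)]. *)
Lemma normalize_local_angle (theta a b : R) :
  0 < cos theta * a + sin theta * b ->
  ((a, b) / RtoC (Cmod (a, b)))%C =
  cis (theta + atan ((- sin theta * a + cos theta * b) / (cos theta * a + sin theta * b))).
Proof.
  set (c := cos theta); set (s := sin theta).
  set (l1 := c * a + s * b); set (l2 := - s * a + c * b); intros Hl1.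
  assert (Hcs : s * s + c * c = 1)
    by (pose proof (sin2_cos2 theta) as H; unfold Rsqr in H; exact H).
  assert (Hsum : a * a + b * b = l1 * l1 + l2 * l2).
  { unfold l1, l2.
    replace (_ + _) with ((s * s + c * c) * (a * a + b * b)) at 1 by (rewrite Hcs; ring).
    ring. }
  assert (Hpos : 0 < a * a + b * b) by (rewrite Hsum; nra).
  assert (Hr : Cmod (a, b) = sqrt (a * a + b * b))
    by (unfold Cmod; simpl; f_equal; ring).
  set (r := Cmod (a, b)) in *.
  assert (Hr0 : 0 < r) by (rewrite Hr; now apply sqrt_lt_R0).
  assert (Hq : sqrt (1 + (l2 / l1)²) = r / l1).
  { replace (1 + (l2 / l1)²) with ((l1 * l1 + l2 * l2) / l1²)
      by (unfold Rsqr; field; lra).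
    rewrite sqrt_div_alt, sqrt_Rsqr by (unfold Rsqr; nra).
    now rewrite Hr, Hsum. }
  unfold cis; rewrite cos_plus, sin_plus, cos_atan, sin_atan, Hq.
  fold c s.
  unfold Cdiv, Cmult, Cinv, RtoC; simpl.
  assert (Ea : a = c * l1 - s * l2).
  { unfold l1, l2; replace a with ((s * s + c * c) * a) at 1 by (rewrite Hcs; ring); ring. }
  assert (Eb : b = s * l1 + c * l2).
  { unfold l1, l2; replace b with ((s * s + c * c) * b) at 1 by (rewrite Hcs; ring); ring. }
  f_equal.
  - rewrite Ea at 1. rewrite Eb at 1. field; repeat split; nra.
  - rewrite Ea at 1. rewrite Eb at 1. field; repeat split; nra.
Qed.

(** Near the point of polar coordinates [(r, theta)] the potential is the product of
a function of [|y|^2] and of the angular profile composed with the local branch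
of the argument.  The result is the sum of a radial component
[- alpha r^{-alpha-1} U] and an orthoradial one [r^{-alpha-1} U']. *)
Lemma is_gradient_potential (alpha : R) (u : C -> R) (r theta d : R) :
  0 < r -> is_derive (angular u) theta d ->
  is_gradient (potential alpha u) (r * cos theta, r * sin theta)
    (Rpower r (- alpha) / r * (- alpha * angular u theta * cos theta - d * sin theta),
     Rpower r (- alpha) / r * (- alpha * angular u theta * sin theta + d * cos theta)).
Proof.
  intros Hr Hd.
  set (c := cos theta); set (s := sin theta); set (z := (r * c, r * s) : C).
  assert (Hcs : s * s + c * c = 1)
    by (pose proof (sin2_cos2 theta) as H; unfold Rsqr in H; exact H).
  pose proof (is_gradient_linear c s z) as G1.
  pose proof (is_gradient_linear (- s) c z) as G2.
  assert (L1z : c * Re z + s * Im z = r).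
  { simpl; replace (c * (r * c) + s * (r * s)) with ((s * s + c * c) * r) by ring.
    rewrite Hcs; ring. }
  assert (L2z : - s * Re z + c * Im z = 0) by (simpl; ring).
  assert (GN : is_gradient (fun y => Re y * Re y + Im y * Im y) z (2 * r * c, 2 * r * s)).
  { assert (G3 : is_gradient Re z (1, 0)).
    { apply is_gradient_ext_loc with (2 := is_gradient_linear 1 0 z).
      apply filter_forall; intros y; ring. }
    assert (G4 : is_gradient Im z (0, 1)).
    { apply is_gradient_ext_loc with (2 := is_gradient_linear 0 1 z).
      apply filter_forall; intros y; ring. }
    eapply is_gradient_eq.
    - apply (is_gradient_plus _ _ _ _ _ _ _ (is_gradient_mult _ _ _ _ _ _ _ G3 G3)
        (is_gradient_mult _ _ _ _ _ _ _ G4 G4)).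
    - simpl; f_equal; ring. }
  assert (GQ : is_gradient (fun y => angular u
      (theta + atan ((- s * Re y + c * Im y) * / (c * Re y + s * Im y)))) z
      (- d * s / r, d * c / r)).
  { eapply is_gradient_eq.
    - apply (is_gradient_comp
        (fun y => (- s * Re y + c * Im y) * / (c * Re y + s * Im y))
        (fun q => angular u (theta + atan q)) z).
      + apply is_gradient_mult; [exact G2|].
        apply (is_gradient_comp _ (fun y => / y) z _ _ (- / (r * r)) G1).
        cbv beta; rewrite L1z; auto_derive; [lra | field; lra].
      + cbv beta; rewrite L2z, Rmult_0_l.
        eapply is_derive_ext; [intros; reflexivity|].
        apply (is_derive_comp (angular u) (fun q => theta + atan q) 0 d 1).
        * rewrite atan_0, Rplus_0_r; exact Hd.
        * auto_derive; trivial. field.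
    - cbv beta; rewrite L1z, L2z; simpl; unfold scal, one; simpl; unfold mult; simpl.
      f_equal; field; lra. }
  assert (Nz : Re z * Re z + Im z * Im z = r * r).
  { simpl; replace (_ + _) with ((s * s + c * c) * (r * r)) by ring; rewrite Hcs; ring. }
  assert (Hsq : sqrt (r * r) = r) by (apply sqrt_square; lra).
  assert (GP : is_gradient
      (fun y => exp (- alpha * ln (sqrt (Re y * Re y + Im y * Im y)))) z
      (Rpower r (- alpha) / r * (- alpha * c), Rpower r (- alpha) / r * (- alpha * s))).
  { eapply is_gradient_eq.
    - apply (is_gradient_comp _ (fun n => exp (- alpha * ln (sqrt n))) z _ _
        (Rpower r (- alpha) * - alpha / (2 * r * r)) GN).
      cbv beta; rewrite Nz; auto_derive; rewrite ?Hsq; [repeat split; nra|].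
      unfold Rpower; field; lra.
    - f_equal; field; lra. }
  eapply is_gradient_eq.
  - refine (is_gradient_ext_loc _ _ _ _ _ (is_gradient_mult _ _ _ _ _ _ _ GP GQ)).
    pose proof (locally_is_gradient_pos _ _ _ G1 ltac:(cbv beta; rewrite L1z; exact Hr)) as Hloc.
    revert Hloc; apply filter_imp; intros [a b] Hab.
    unfold potential, Rpower; rewrite (normalize_local_angle theta a b Hab).
    unfold angular, Rdiv; f_equal.
    f_equal; f_equal; f_equal; unfold Cmod; f_equal; simpl; ring.
  - cbv beta; rewrite Nz, L1z, L2z, Hsq, Rmult_0_l, atan_0, Rplus_0_r.
    fold (Rpower r (- alpha)). f_equal; field; lra.
Qed.

(** * The equations of motion in polar coordinates *)

(** The equations of motion for [w = |x|^2], [p = <x, x'>], the angle [th] and the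
angular momentum [J].  The derivative of [p] is the Lagrange-Jacobi identity, in
which the kinetic energy has been eliminated by means of the energy; the last
field keeps the energy relation that this elimination uses. *)
Record polar_solution (alpha : R) (U dU : R -> R) (h : R) (w p th J : R -> R) : Prop := {
  polar_pos : forall t, 0 < w t;
  polar_w : forall t, is_derive w t (2 * p t);
  polar_p : forall t,
    is_derive p t (2 * h + (2 - alpha) * Rpower (w t) (- alpha / 2) * U (th t));
  polar_th : forall t, is_derive th t (J t / w t);
  polar_J : forall t, is_derive J t (Rpower (w t) (- alpha / 2) * dU (th t));
  polar_energy : forall t,
    p t * p t + J t * J t = 2 * h * w t + 2 * w t * Rpower (w t) (- alpha / 2) * U (th t)
}.

Arguments polar_w {alpha U dU h w p th J} _ _.
Arguments polar_p {alpha U dU h w p th J} _ _.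

Definition polar_curve (w th : R -> R) (t : R) : C :=
  (sqrt (w t) * cos (th t), sqrt (w t) * sin (th t)).

(** The velocity is [(p + i J) e^{i th} / r].  Once the energy relation has been used
to eliminate [h], the radial and orthoradial parts of its derivative are those of
the gradient. *)
Lemma polar_energy_solution (alpha h : R) (u : C -> R) (dU w p th J : R -> R) :
  (forall theta, is_derive (angular u) theta (dU theta)) ->
  polar_solution alpha (angular u) dU h w p th J ->
  energy_solution (potential alpha u) h (polar_curve w th).
Proof.
  intros HU [Hw Dw Dp Dth DJ He].
  exists (fun t => ((p t * cos (th t) - J t * sin (th t)) / sqrt (w t),
                    (p t * sin (th t) + J t * cos (th t)) / sqrt (w t))).
  exists (fun t =>
    (Rpower (sqrt (w t)) (- alpha) / sqrt (w t) *
       (- alpha * angular u (th t) * cos (th t) - dU (th t) * sin (th t)),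
     Rpower (sqrt (w t)) (- alpha) / sqrt (w t) *
       (- alpha * angular u (th t) * sin (th t) + dU (th t) * cos (th t)))).
  intros t.
  specialize (Hw t); specialize (Dw t); specialize (Dp t); specialize (Dth t);
    specialize (DJ t); specialize (He t).
  set (S := sqrt (w t)).
  assert (HS : 0 < S) by (apply sqrt_lt_R0; trivial).
  assert (HSS : S * S = w t) by (apply sqrt_sqrt; lra).
  assert (Hf : Rpower S (- alpha) = Rpower (w t) (- alpha / 2)).
  { unfold S; rewrite <- Rpower_sqrt by trivial; rewrite Rpower_mult; f_equal; field. }
  set (f := Rpower (w t) (- alpha / 2)) in *.
  set (c := cos (th t)); set (s := sin (th t)).
  assert (Hcs : s * s + c * c = 1)
    by (pose proof (sin2_cos2 (th t)) as H; unfold Rsqr in H; exact H).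
  (* The energy relation, solved for [h], is all that the computation needs. *)
  assert (Eh : 2 * h = (p t * p t + J t * J t) / (S * S) - 2 * f * angular u (th t)).
  { rewrite He, HSS; field; lra. }
  assert (Xw : ex_derive w t) by (eexists; exact Dw).
  assert (Xp : ex_derive p t) by (eexists; exact Dp).
  assert (Xth : ex_derive th t) by (eexists; exact Dth).
  assert (XJ : ex_derive J t) by (eexists; exact DJ).
  apply is_derive_unique in Dw; apply is_derive_unique in Dp;
    apply is_derive_unique in Dth; apply is_derive_unique in DJ.
  change (Derive (fun x => w x) t = 2 * p t) in Dw.
  change (Derive (fun x => th x) t = J t / w t) in Dth.
  change (Derive (fun x => J x) t = f * dU (th t)) in DJ.
  change (Derive (fun x => p x) t =
    2 * h + (2 - alpha) * f * angular u (th t)) in Dp.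
  split; [|split; [|split; [|split]]].
  - unfold polar_curve; intros E; injection E as E1 E2; fold S in E1, E2.
    fold c in E1; fold s in E2; nra.
  - apply is_derive_C; (auto_derive; [repeat split; trivial|]);
      rewrite Dw, Dth; fold S c s; rewrite <- HSS; field; lra.
  - rewrite Hf.
    apply is_derive_C; (auto_derive; [fold S; repeat split; trivial; lra|]);
      rewrite Dw, Dth, Dp, DJ; fold S c s; rewrite Eh, <- HSS; field; lra.
  - apply (is_gradient_potential alpha u S (th t) (dU (th t))); trivial.
  - assert (HV : potential alpha u (polar_curve w th t) = f * angular u (th t)).
    { pose proof (normalize_local_angle (th t) (S * c) (S * s)) as Hn.
      fold c s in Hn.
      assert (E1 : c * (S * c) + s * (S * s) = S).
      { replace (_ + _) with ((s * s + c * c) * S) by ring; rewrite Hcs; ring. }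
      assert (E2 : - s * (S * c) + c * (S * s) = 0) by ring.
      rewrite E1, E2 in Hn.
      replace (0 / S) with 0 in Hn by (field; lra).
      rewrite atan_0, Rplus_0_r in Hn.
      unfold potential, polar_curve; fold S c s; rewrite (Hn HS).
      unfold angular; f_equal. rewrite <- Hf; f_equal.
      unfold Cmod; simpl.
      replace (_ + _) with ((s * s + c * c) * (S * S)) by ring.
      rewrite Hcs, Rmult_1_l; apply sqrt_square; lra. }
    rewrite HV. unfold Cmod; rewrite pow2_sqrt.
    2: { simpl; rewrite !Rmult_1_r; apply Rplus_le_le_0_compat; apply Rle_0_sqr. }
    simpl; fold S c s.
    replace (_ * (_ * 1) + _) with ((s * s + c * c) * (p t * p t + J t * J t) / (S * S))
      by (field; lra).
    rewrite Hcs. replace h with (/ 2 * (2 * h)) by field. rewrite Eh; field; lra.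
Qed.

(** Scaling lengths by [lam] and times by [mu] maps solutions to solutions when
[mu^2 = lam^{alpha + 2}], and multiplies the energy by [lam^{-alpha}].  The factor
[lam] is chosen for the energy [h], and then the speed at infinity [lam / mu] is
[sqrt (2 h)]. *)
Lemma polar_rescale (alpha h : R) (U dU w p th J : R -> R) :
  0 < alpha -> 0 < h -> polar_solution alpha U dU (/ 2) w p th J ->
  exists lam mu, 0 < lam /\ 0 < mu /\ lam = sqrt (2 * h) * mu /\
  polar_solution alpha U dU h (fun t => lam * lam * w (t / mu))
    (fun t => lam * lam / mu * p (t / mu)) (fun t => th (t / mu))
    (fun t => lam * lam / mu * J (t / mu)).
Proof.
  intros Ha Hh [Hw Dw Dp Dth DJ He].
  set (lam := Rpower (2 * h) (- / alpha)).
  set (S := sqrt (2 * h)).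
  assert (HS : 0 < S) by (apply sqrt_lt_R0; lra).
  assert (HSS : S * S = 2 * h) by (apply sqrt_sqrt; lra).
  assert (Hlam : 0 < lam) by apply exp_pos.
  exists lam, (lam / S).
  assert (Hmu : 0 < lam / S) by (apply Rdiv_lt_0_compat; trivial).
  set (mu := lam / S) in *.
  assert (Emu : lam = S * mu) by (unfold mu; field; lra).
  assert (Hpow : forall x, 0 < x ->
    Rpower (lam * lam * x) (- alpha / 2) = 2 * h * Rpower x (- alpha / 2)).
  { intros x Hx.
    rewrite <- (Rpower_mult_distr (lam * lam)) by (trivial; nra).
    rewrite <- (Rpower_mult_distr lam lam) by trivial. f_equal.
    rewrite <- Rpower_plus. unfold lam; rewrite Rpower_mult.
    replace (- / alpha * (- alpha / 2 + - alpha / 2)) with 1 by (field; lra).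
    apply Rpower_1; lra. }
  assert (Dg : forall (g : R -> R) d t, is_derive g (t / mu) d ->
    is_derive (fun t => g (t / mu)) t (d / mu)).
  { intros g d t Hg.
    replace (d / mu) with (scal (/ mu) d) by (unfold scal; simpl; unfold mult; simpl; field; lra).
    apply (is_derive_comp g (fun t => t / mu)); trivial.
    auto_derive; trivial; field; lra. }
  do 3 (split; trivial). split.
  - intros t; apply Rmult_lt_0_compat; [nra | apply Hw].
  - intros t. replace (2 * _) with (lam * lam * (2 * p (t / mu) / mu)) by (field; lra).
    apply is_derive_scal; apply Dg, Dw.
  - intros t. rewrite Hpow by apply Hw.
    replace (2 * h + _) with (lam * lam / mu *
      ((2 * / 2 + (2 - alpha) * Rpower (w (t / mu)) (- alpha / 2) * U (th (t / mu))) / mu)).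
    + apply is_derive_scal; apply Dg, Dp.
    + rewrite Emu, <- HSS; field; lra.
  - intros t. replace (_ / _) with (J (t / mu) / w (t / mu) / mu)
      by (pose proof (Hw (t / mu)); field; lra).
    apply Dg, Dth.
  - intros t. rewrite Hpow by apply Hw.
    replace (_ * dU _) with (lam * lam / mu *
      ((Rpower (w (t / mu)) (- alpha / 2) * dU (th (t / mu))) / mu)).
    + apply is_derive_scal; apply Dg, DJ.
    + rewrite Emu, <- HSS; field; lra.
  - intros t. rewrite Hpow by apply Hw. specialize (He (t / mu)).
    replace (_ + _) with (lam * lam / mu * (lam * lam / mu) *
      (p (t / mu) * p (t / mu) + J (t / mu) * J (t / mu))) by ring.
    rewrite He, <- HSS.
    rewrite Emu at 1 2 3 4; rewrite Emu. field; lra.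
Qed.

(** A bounded error on the radius and a vanishing error on the angle amount together
to an error [o(|t|)] on the position. *)
Lemma polar_asymptotic_direction (w th : R -> R) (h theta c : R) (l : Rbar) :
  l = p_infty \/ l = m_infty ->
  (forall t, Rabs (sqrt (w t) - sqrt (2 * h) * Rabs t) <= c) ->
  is_lim th l theta ->
  asymptotic_direction (polar_curve w th) h theta l.
Proof.
  intros Hl Hw Hth eps.
  set (S := sqrt (2 * h)) in *.
  assert (HS : 0 <= S) by apply sqrt_pos.
  assert (He : 0 < eps / (4 * (S + 1))).
  { apply Rdiv_lt_0_compat; [apply cond_pos | lra]. }
  assert (He' : S * (eps / (4 * (S + 1))) <= eps / 4).
  { replace (eps / 4) with ((S + 1) * (eps / (4 * (S + 1)))) by (field; lra).
    apply Rmult_le_compat_r; lra. }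
  assert (Hlarge : Rbar_locally' l (fun t => 4 * c / eps < Rabs t)).
  { destruct Hl as [-> | ->]; [exists (4 * c / eps) | exists (- (4 * c / eps))];
      intros t Ht; unfold Rabs; destruct Rcase_abs; lra. }
  assert (Htrig : forall g : R -> R, continuous g theta ->
    Rbar_locally' l (fun t => Rabs (g (th t) - g theta) < eps / (4 * (S + 1)))).
  { intros g Hg.
    apply (filterlim_comp _ _ _ th g _ _ _ Hth Hg
      (fun y => Rabs (y - g theta) < eps / (4 * (S + 1)))).
    exists (mkposreal _ He); intros y Hy; exact Hy. }
  assert (E : forall P : R -> Prop, Rbar_locally' l P -> Rbar_locally l P)
    by (destruct Hl as [-> | ->]; trivial).
  apply E.
  pose proof (Htrig cos (ex_derive_continuous cos theta
    (ex_intro _ _ (is_derive_cos theta)))) as Hcos.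
  pose proof (Htrig sin (ex_derive_continuous sin theta
    (ex_intro _ _ (is_derive_sin theta)))) as Hsin.
  generalize (filter_and _ _ Hlarge (filter_and _ _ Hcos Hsin)).
  apply filter_imp; intros t [Ht [Hc Hs]].
  specialize (Hw t).
  assert (Hb : forall a b, Rabs a <= 1 -> Rabs (a - b) < eps / (4 * (S + 1)) ->
    Rabs (sqrt (w t) * a - S * Rabs t * b) <= eps / 2 * Rabs t).
  { intros a b Ha Hab.
    replace (_ - _) with ((sqrt (w t) - S * Rabs t) * a + Rabs t * (S * (a - b))) by ring.
    apply Rle_trans with (1 := Rabs_triang _ _).
    rewrite !Rabs_mult, Rabs_Rabsolu, (Rabs_pos_eq S HS).
    pose proof (cond_pos eps). pose proof (Rabs_pos t). pose proof (Rabs_pos a).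
    pose proof (Rabs_pos (sqrt (w t) - S * Rabs t)).
    assert (c <= eps / 4 * Rabs t).
    { replace c with (eps / 4 * (4 * c / eps)) by (field; lra).
      apply Rmult_le_compat_l; lra. }
    assert (S * Rabs (a - b) <= eps / 4).
    { apply Rle_trans with (2 := He'); apply Rmult_le_compat_l; lra. }
    pose proof (Rmult_le_compat_l (Rabs t) _ _ ltac:(lra) H4).
    nra. }
  assert (Hn : forall a b : R, norm (V := C_R_NormedModule) ((a, b) : C) <= Rabs a + Rabs b).
  { intros a b.
    change (sqrt (Rabs a ^ 2 + Rabs b ^ 2) <= Rabs a + Rabs b).
    pose proof (Rabs_pos a); pose proof (Rabs_pos b).
    rewrite <- (sqrt_pow2 (Rabs a + Rabs b)) by lra.
    apply sqrt_le_1_alt; nra. }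
  apply Rle_trans with (Rabs (sqrt (w t) * cos (th t) - S * Rabs t * cos theta) +
    Rabs (sqrt (w t) * sin (th t) - S * Rabs t * sin theta)).
  - eapply Rle_trans; [|apply Hn].
    right; f_equal. unfold polar_curve, cis, Cminus, Cplus, Copp, Cmult, RtoC; simpl.
    f_equal; fold S; ring.
  - pose proof (Hb _ _ (Rabs_le _ _ (COS_bound (th t))) Hc) as B1.
    pose proof (Hb _ _ (Rabs_le _ _ (SIN_bound (th t))) Hs) as B2.
    change (norm (Rabs t)) with (Rabs (Rabs t)); rewrite Rabs_Rabsolu; lra.
Qed.

(** * Calculus for derivatives with integrable decay *)

Lemma derive_nonneg_le (g dg : R -> R) (a b : R) :
  a <= b -> (forall x, a <= x <= b -> is_derive g x (dg x) /\ 0 <= dg x) -> g a <= g b.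
Proof.
  intros Hab H.
  destruct (MVT_gen g a b dg) as [c [Hc E]];
    rewrite ?Rmin_left, ?Rmax_right in * by trivial.
  - intros x Hx; apply H; lra.
  - intros x Hx; apply continuity_pt_filterlim, (ex_derive_continuous (V := R_NormedModule) g).
    eexists; apply H; lra.
  - pose proof (proj2 (H c Hc)); nra.
Qed.

(** The mean value inequality with a varying bound on the derivative.  It stands
for improper integrals in the estimates below. *)
Lemma derive_le_compare (y dy G dG : R -> R) (a b : R) :
  a <= b ->
  (forall x, a <= x <= b -> is_derive y x (dy x) /\ is_derive G x (dG x) /\ Rabs (dy x) <= dG x) ->
  Rabs (y b - y a) <= G b - G a.
Proof.
  intros Hab H.
  (* [G - y] and [G + y] are both nondecreasing. *)
  assert (H1 : G a - y a <= G b - y b).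
  { apply (derive_nonneg_le (fun x => G x - y x) (fun x => dG x - dy x)); trivial.
    intros x Hx; destruct (H x Hx) as [D1 [D2 D3]]; split.
    - apply (is_derive_minus G y); trivial.
    - pose proof (Rle_abs (dy x)); lra. }
  assert (H2 : G a + y a <= G b + y b).
  { apply (derive_nonneg_le (fun x => G x + y x) (fun x => dG x + dy x)); trivial.
    intros x Hx; destruct (H x Hx) as [D1 [D2 D3]]; split.
    - apply (is_derive_plus G y); trivial.
    - pose proof (Rle_abs (- dy x)) as Ha; rewrite Rabs_Ropp in Ha; lra. }
  apply Rabs_le; lra.
Qed.

Lemma derive_bounded_lipschitz (g dg : R -> R) (K x y : R) :
  (forall z, Rmin x y <= z <= Rmax x y -> is_derive g z (dg z) /\ Rabs (dg z) <= K) ->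
  Rabs (g x - g y) <= K * Rabs (x - y).
Proof.
  assert (Hle : forall a b, a <= b ->
    (forall z, a <= z <= b -> is_derive g z (dg z) /\ Rabs (dg z) <= K) ->
    Rabs (g b - g a) <= K * (b - a)).
  { intros a b Hab H.
    replace (K * (b - a)) with (K * b - K * a) by ring.
    apply (derive_le_compare g dg (fun z => K * z) (fun _ => K)); trivial.
    intros z Hz; split; [apply H | split; [|apply H]]; trivial.
    auto_derive; trivial; ring. }
  intros H; destruct (Rle_dec x y) as [Hxy|Hxy].
  - rewrite Rmin_left, Rmax_right in H by trivial.
    rewrite Rabs_minus_sym, (Rabs_minus_sym x), (Rabs_pos_eq (y - x)) by lra; auto.
  - rewrite Rmin_right, Rmax_left in H by lra.
    rewrite (Rabs_pos_eq (x - y)) by lra; apply Hle; trivial; lra.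
Qed.

Lemma Rpower_le_nonpos (x y a : R) :
  0 < x <= y -> a <= 0 -> Rpower y a <= Rpower x a.
Proof.
  intros Hxy Ha; unfold Rpower.
  assert (Hln : ln x <= ln y) by (destruct (proj2 Hxy) as [H| ->]; [left; apply ln_increasing|]; lra).
  destruct (Req_dec (a * ln y) (a * ln x)) as [->|Hn]; [lra|].
  left; apply exp_increasing; nra.
Qed.

(** A common integrable bound for the derivatives of [J] and [th].  The exponent
[3/2] fits [w^{-alpha/2}] for [alpha >= 3/2], and [- 2 / sqrt (1 + t)] is a
primitive on the positive half-line. *)
Definition decay (t : R) : R := / ((1 + Rabs t) * sqrt (1 + Rabs t)).

(** The variation on [s <= x <= t] is at most that of [- 2 K / sqrt (1 + x)]. *)
Lemma decay_variation (y dy : R -> R) (K s t : R) :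
  0 <= s <= t ->
  (forall x, s <= x <= t -> is_derive y x (dy x) /\ Rabs (dy x) <= K * decay x) ->
  Rabs (y t - y s) <= 2 * K / sqrt (1 + s).
Proof.
  intros Hst H.
  assert (HK : 0 <= K).
  { destruct (H s ltac:(lra)) as [_ Hs].
    assert (0 < decay s).
    { apply Rinv_0_lt_compat, Rmult_lt_0_compat; [|apply sqrt_lt_R0];
        pose proof (Rabs_pos s); lra. }
    pose proof (Rabs_pos (dy s)); nra. }
  assert (Hv : Rabs (y t - y s) <= - 2 * K / sqrt (1 + t) - (- 2 * K / sqrt (1 + s))).
  { apply (derive_le_compare y dy (fun x => - 2 * K / sqrt (1 + x)) (fun x => K * decay x));
      [lra|].
    intros x Hx; destruct (H x Hx) as [D1 D2]; split; [|split]; trivial.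
    assert (0 < sqrt (1 + x)) by (apply sqrt_lt_R0; lra).
    unfold decay; rewrite Rabs_pos_eq by lra.
    auto_derive; [repeat split; lra|].
    assert (E : 1 + x = sqrt (1 + x) * sqrt (1 + x)) by (rewrite sqrt_sqrt; lra).
    set (S := sqrt (1 + x)) in *; rewrite E; field; lra. }
  assert (0 < sqrt (1 + t)) by (apply sqrt_lt_R0; lra).
  assert (0 <= 2 * K / sqrt (1 + t)).
  { apply Rmult_le_pos; [lra | left; now apply Rinv_0_lt_compat]. }
  unfold Rdiv in *; lra.
Qed.

Lemma square_one_plus_abs (t : R) : (1 + Rabs t) * (1 + Rabs t) <= 2 * (1 + t * t).
Proof.
  replace (t * t) with (Rabs t * Rabs t) by (rewrite <- Rabs_mult; apply Rabs_pos_eq; nra).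
  pose proof (Rle_0_sqr (1 - Rabs t)) as H; unfold Rsqr in H; lra.
Qed.

Lemma decay_inv_le (c t : R) : 0 < c -> / (c * (1 + t * t)) <= 2 / c * decay t.
Proof.
  intros Hc; unfold decay.
  set (a := 1 + Rabs t).
  assert (Ha : 1 <= a) by (unfold a; pose proof (Rabs_pos t); lra).
  assert (Hs : 1 <= sqrt a) by (rewrite <- sqrt_1; apply sqrt_le_1_alt; lra).
  assert (Hss : sqrt a * sqrt a = a) by (apply sqrt_sqrt; lra).
  assert (Hat : a * a <= 2 * (1 + t * t)).
  { pose proof (square_one_plus_abs t) as Ht; fold a in Ht; lra. }
  assert (Hle : a * sqrt a <= 2 * (1 + t * t)) by nra.
  assert (0 < a * sqrt a) by nra.
  replace (2 / c * / (a * sqrt a)) with (/ (c * (a * sqrt a / 2))) by (field; lra).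
  apply Rinv_le_contravar; [nra|].
  apply Rmult_le_compat_l; lra.
Qed.

Lemma decay_Rpower_le (alpha c x t : R) :
  3 / 2 <= alpha <= 2 -> 0 < c <= 1 -> c * (1 + t * t) <= x ->
  Rpower x (- alpha / 2) <= 2 / c * decay t.
Proof.
  intros Ha Hc Hx.
  set (a := 1 + Rabs t).
  assert (Ha1 : 1 <= a) by (unfold a; pose proof (Rabs_pos t); lra).
  assert (Hat : a * a / 2 <= 1 + t * t).
  { pose proof (square_one_plus_abs t) as Ht; fold a in Ht; lra. }
  apply Rle_trans with (Rpower ((c / 2) * (a * a)) (- alpha / 2)).
  { apply Rpower_le_nonpos; [split | lra].
    - apply Rmult_lt_0_compat; nra.
    - apply Rle_trans with (2 := Hx).
      replace (c / 2 * (a * a)) with (c * (a * a / 2)) by field.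
      apply Rmult_le_compat_l; lra. }
  rewrite <- Rpower_mult_distr by nra.
  apply Rmult_le_compat; try (left; apply exp_pos).
  - apply Rle_trans with (Rpower (c / 2) (- (1))).
    + unfold Rpower.
      assert (Hln : ln (c / 2) < 0) by (rewrite <- ln_1; apply ln_increasing; lra).
      destruct (Req_dec (- alpha / 2 * ln (c / 2)) (- (1) * ln (c / 2))) as [->|Hn]; [lra|].
      left; apply exp_increasing; nra.
    + rewrite Rpower_Ropp, Rpower_1 by lra. right; field; lra.
  - unfold decay; fold a.
    rewrite <- Rpower_mult_distr by lra. rewrite <- Rpower_plus.
    rewrite <- (Rpower_sqrt a) by lra. rewrite <- (Rpower_1 a) at 2 by lra.
    rewrite <- Rpower_plus, <- Rpower_Ropp.
    destruct (Req_dec a 1) as [->|Hn].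
    + unfold Rpower; rewrite ln_1, !Rmult_0_r; lra.
    + apply Rle_Rpower; lra.
Qed.

Lemma is_derive_reflect (y : R -> R) (d t : R) :
  is_derive y (- t) d -> is_derive (fun s => y (- s)) t (- d).
Proof.
  intros H. replace (- d) with (scal (-1) d) by (unfold scal; simpl; unfold mult; simpl; ring).
  apply (is_derive_comp y (fun s => - s)); trivial.
  auto_derive; trivial; ring.
Qed.

Lemma decay_bounded (y dy : R -> R) (K t : R) :
  (forall x, is_derive y x (dy x) /\ Rabs (dy x) <= K * decay x) ->
  Rabs (y t - y 0) <= 2 * K.
Proof.
  intros H.
  replace (2 * K) with (2 * K / sqrt (1 + 0)) by (rewrite Rplus_0_r, sqrt_1; field).
  destruct (Rle_dec 0 t) as [Ht|Ht].
  - apply decay_variation with dy; [lra|]; intros; apply H.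
  - pose proof (decay_variation (fun s => y (- s)) (fun s => - dy (- s)) K 0 (- t)) as Hv.
    cbv beta in Hv; rewrite Ropp_0, Ropp_involutive in Hv; apply Hv; [lra|].
    intros x _; destruct (H (- x)) as [D B]; split; [now apply is_derive_reflect|].
    unfold decay in *; rewrite Rabs_Ropp in *; exact B.
Qed.

Lemma decay_limit (y dy : R -> R) (K : R) :
  (forall x, is_derive y x (dy x) /\ Rabs (dy x) <= K * decay x) ->
  exists l : R, is_lim y p_infty l /\
    forall t, 0 <= t -> Rabs (l - y t) <= 2 * K / sqrt (1 + t).
Proof.
  intros H.
  assert (HK : 0 <= 2 * K) by (pose proof (decay_bounded y dy K 0 H);
    pose proof (Rabs_pos (y 0 - y 0)); lra).
  assert (Hv : forall s t, 0 <= s <= t -> Rabs (y t - y s) <= 2 * K / sqrt (1 + s))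
    by (intros; apply decay_variation with dy; trivial; intros; apply H).
  assert (Htail : forall eps, 0 < eps -> exists T, 0 <= T /\ 2 * K / sqrt (1 + T) < eps).
  { intros eps He. exists ((2 * K / eps + 1) * (2 * K / eps + 1)).
    set (q := 2 * K / eps).
    assert (Hq : 0 <= q) by (apply Rmult_le_pos; [lra | left; now apply Rinv_0_lt_compat]).
    split; [nra|].
    assert (Hs : q + 1 <= sqrt (1 + (q + 1) * (q + 1))).
    { rewrite <- (sqrt_square (q + 1)) at 1 by lra. apply sqrt_le_1_alt; lra. }
    apply Rmult_lt_reg_r with (sqrt (1 + (q + 1) * (q + 1))); [lra|].
    unfold Rdiv; rewrite Rmult_assoc, Rinv_l, Rmult_1_r by lra.
    replace (2 * K) with (eps * q) by (unfold q; field; lra). nra. }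
  destruct (proj1 (filterlim_locally_cauchy (U := R_CompleteSpace) (F := Rbar_locally' p_infty) y)) as [l Hl].
  { intros eps. destruct (Htail (eps / 2) ltac:(pose proof (cond_pos eps); lra)) as [T [HT0 HT]].
    exists (fun t => T < t); split; [now exists T|].
    intros s t Hs Ht.
    change (Rabs (y t - y s) < eps).
    pose proof (Hv T s ltac:(lra)); pose proof (Hv T t ltac:(lra)).
    replace (y t - y s) with ((y t - y T) - (y s - y T)) by ring.
    apply Rle_lt_trans with (1 := Rabs_triang _ _); rewrite Rabs_Ropp; lra. }
  exists l; split; [exact Hl|].
  intros t Ht. apply le_epsilon; intros eps He.
  destruct (Hl (fun z => Rabs (z - l) < eps)) as [M HM].
  { exists (mkposreal eps He); intros z Hz; exact Hz. }
  specialize (HM (Rmax (M + 1) t) ltac:(pose proof (Rmax_l (M + 1) t); lra)).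
  pose proof (Hv t (Rmax (M + 1) t) ltac:(pose proof (Rmax_r (M + 1) t); lra)).
  set (z := y (Rmax (M + 1) t)) in *.
  replace (l - y t) with (- (z - l) + (z - y t)) by ring.
  apply Rle_trans with (1 := Rabs_triang _ _); rewrite Rabs_Ropp; lra.
Qed.

(** * Trajectories starting at an apex *)

(** Boundedness is part of the notion because products have to stay Lipschitz. *)
Definition bounded_lipschitz {V : NormedModule R_AbsRing} (g : V -> R) : Prop :=
  exists K, forall x y, Rabs (g x) <= K /\ Rabs (g x - g y) <= K * norm (minus x y).

Lemma bounded_lipschitz_mult {V : NormedModule R_AbsRing} (g k : V -> R) :
  bounded_lipschitz g -> bounded_lipschitz k -> bounded_lipschitz (fun x => g x * k x).
Proof.
  intros [A HA] [B HB].
  exists (2 * A * B + A * B); intros x y.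
  destruct (HA x y) as [A1 A2], (HB x y) as [B1 B2].
  destruct (HA y x) as [A3 _].
  pose proof (Rabs_pos (g x)); pose proof (Rabs_pos (k x)).
  pose proof (norm_ge_0 (minus x y)).
  assert (0 <= A * B) by (apply Rmult_le_pos; lra).
  split.
  - rewrite Rabs_mult. apply Rle_trans with (A * B); [apply Rmult_le_compat|]; lra.
  - replace (g x * k x - g y * k y) with ((g x - g y) * k x + g y * (k x - k y)) by ring.
    apply Rle_trans with (1 := Rabs_triang _ _); rewrite !Rabs_mult.
    set (n := norm (minus x y)) in *.
    assert (Rabs (g x - g y) * Rabs (k x) <= A * n * B)
      by (apply Rmult_le_compat; trivial; apply Rabs_pos).
    assert (Rabs (g y) * Rabs (k x - k y) <= A * (B * n))
      by (apply Rmult_le_compat; trivial; apply Rabs_pos).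
    nra.
Qed.

Lemma bounded_lipschitz_comp {V : NormedModule R_AbsRing} (g : R -> R) (q : V -> R) (A L : R) :
  (forall a, Rabs (g a) <= A) -> (forall a b, Rabs (g a - g b) <= L * Rabs (a - b)) ->
  (forall x y, Rabs (q x - q y) <= norm (minus x y)) ->
  bounded_lipschitz (fun x => g (q x)).
Proof.
  intros HA HL Hq.
  assert (A0 : 0 <= A) by (pose proof (HA 0); pose proof (Rabs_pos (g 0)); lra).
  assert (L0 : 0 <= L).
  { pose proof (HL 1 0) as H1; pose proof (Rabs_pos (g 1 - g 0)).
    rewrite Rminus_0_r, Rabs_R1 in H1; lra. }
  exists (A + L); intros x y; split.
  - pose proof (HA (q x)); lra.
  - pose proof (HL (q x) (q y)); pose proof (Hq x y); pose proof (Rabs_pos (q x - q y)).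
    pose proof (Rmult_le_compat_l L _ _ L0 H0).
    pose proof (Rmult_le_pos A _ A0 (norm_ge_0 (minus x y))). lra.
Qed.

Lemma Rmax_lipschitz (c a b : R) : Rabs (Rmax c a - Rmax c b) <= Rabs (a - b).
Proof.
  unfold Rmax; destruct (Rle_dec c a), (Rle_dec c b);
    unfold Rabs; repeat destruct Rcase_abs; lra.
Qed.

Definition clamp (B x : R) : R := Rmax (- B) (Rmin B x).

Lemma clamp_lipschitz (B a b : R) : Rabs (clamp B a - clamp B b) <= Rabs (a - b).
Proof.
  unfold clamp; apply Rle_trans with (1 := Rmax_lipschitz _ _ _).
  unfold Rmin; destruct (Rle_dec B a), (Rle_dec B b);
    unfold Rabs; repeat destruct Rcase_abs; lra.
Qed.

Lemma clamp_bounded (B x : R) : 0 <= B -> Rabs (clamp B x) <= B.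
Proof.
  intros HB; unfold clamp, Rmax, Rmin.
  destruct (Rle_dec B x); destruct Rle_dec; apply Rabs_le; lra.
Qed.

Lemma clamp_id (B x : R) : Rabs x <= B -> clamp B x = x.
Proof.
  intros Hx; apply Rabs_le_between in Hx; unfold clamp.
  rewrite Rmin_right, Rmax_right; lra.
Qed.

Definition phase_space : CompleteNormedModule R_AbsRing :=
  prod_CompleteNormedModule
    (prod_CompleteNormedModule R_CompleteNormedModule R_CompleteNormedModule)
    (prod_CompleteNormedModule R_CompleteNormedModule R_CompleteNormedModule).

Definition state (w p th J : R) : phase_space := ((w, p), (th, J)).
Definition st_w (x : phase_space) : R := fst (fst x).
Definition st_p (x : phase_space) : R := snd (fst x).
Definition st_th (x : phase_space) : R := fst (snd x).
Definition st_J (x : phase_space) : R := snd (snd x).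

Lemma sqrt_sum_squares_le (a b : R) :
  0 <= a -> 0 <= b -> sqrt (a ^ 2 + b ^ 2) <= a + b.
Proof.
  intros Ha Hb. rewrite <- (sqrt_pow2 (a + b)) by lra.
  apply sqrt_le_1_alt; nra.
Qed.

Lemma norm_phase_le (x y : phase_space) :
  norm (minus x y) <= Rabs (st_w x - st_w y) + Rabs (st_p x - st_p y) +
    Rabs (st_th x - st_th y) + Rabs (st_J x - st_J y).
Proof.
  set (a := Rabs (st_w x - st_w y)); set (b := Rabs (st_p x - st_p y));
    set (c := Rabs (st_th x - st_th y)); set (d := Rabs (st_J x - st_J y)).
  change (sqrt (sqrt (a ^ 2 + b ^ 2) ^ 2 + sqrt (c ^ 2 + d ^ 2) ^ 2) <= a + b + c + d).
  pose proof (sqrt_sum_squares_le a b (Rabs_pos _) (Rabs_pos _)).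
  pose proof (sqrt_sum_squares_le c d (Rabs_pos _) (Rabs_pos _)).
  pose proof (sqrt_sum_squares_le _ _ (sqrt_pos (a ^ 2 + b ^ 2)) (sqrt_pos (c ^ 2 + d ^ 2))).
  lra.
Qed.

Lemma norm_phase_ge (x y : phase_space) :
  Rabs (st_w x - st_w y) <= norm (minus x y) /\ Rabs (st_p x - st_p y) <= norm (minus x y) /\
  Rabs (st_th x - st_th y) <= norm (minus x y) /\ Rabs (st_J x - st_J y) <= norm (minus x y).
Proof.
  pose proof (norm_le_prod_norm_1 (U := R_NormedModule) (V := R_NormedModule)) as L1.
  pose proof (norm_le_prod_norm_2 (U := R_NormedModule) (V := R_NormedModule)) as L2.
  pose proof (norm_le_prod_norm_1
    (U := prod_NormedModule R_AbsRing R_NormedModule R_NormedModule)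
    (V := prod_NormedModule R_AbsRing R_NormedModule R_NormedModule)
    (minus x y)) as H1.
  pose proof (norm_le_prod_norm_2
    (U := prod_NormedModule R_AbsRing R_NormedModule R_NormedModule)
    (V := prod_NormedModule R_AbsRing R_NormedModule R_NormedModule)
    (minus x y)) as H2.
  split; [|split; [|split]].
  - exact (Rle_trans _ _ _ (L1 (fst (minus x y))) H1).
  - exact (Rle_trans _ _ _ (L2 (fst (minus x y))) H1).
  - exact (Rle_trans _ _ _ (L1 (snd (minus x y))) H2).
  - exact (Rle_trans _ _ _ (L2 (snd (minus x y))) H2).
Qed.

(** Projections are linear, so they commute with differentiation. *)
Lemma is_derive_pair_components {V W : NormedModule R_AbsRing}
  (x : R -> prod_NormedModule R_AbsRing V W) (t : R) (d : prod_NormedModule R_AbsRing V W) :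
  is_derive x t d ->
  is_derive (fun s => fst (x s)) t (fst d) /\ is_derive (fun s => snd (x s)) t (snd d).
Proof.
  intros H; split.
  - apply (filterdiff_comp' (U := R_NormedModule) (V := prod_NormedModule R_AbsRing V W)
      (W := V) x fst t (fun y => scal y d) fst); trivial.
    apply filterdiff_linear, is_linear_fst.
  - apply (filterdiff_comp' (U := R_NormedModule) (V := prod_NormedModule R_AbsRing V W)
      (W := W) x snd t (fun y => scal y d) snd); trivial.
    apply filterdiff_linear, is_linear_snd.
Qed.

Lemma is_derive_phase (x : R -> phase_space) (t : R) (d : phase_space) :
  is_derive x t d ->
  is_derive (fun s => st_w (x s)) t (st_w d) /\ is_derive (fun s => st_p (x s)) t (st_p d) /\
  is_derive (fun s => st_th (x s)) t (st_th d) /\ is_derive (fun s => st_J (x s)) t (st_J d).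
Proof.
  intros H.
  destruct (is_derive_pair_components
    (V := prod_NormedModule R_AbsRing R_NormedModule R_NormedModule)
    (W := prod_NormedModule R_AbsRing R_NormedModule R_NormedModule) x t d H) as [H1 H2].
  destruct (is_derive_pair_components (V := R_NormedModule) (W := R_NormedModule)
    (fun s => fst (x s)) t (fst d) H1) as [D1 D2].
  destruct (is_derive_pair_components (V := R_NormedModule) (W := R_NormedModule)
    (fun s => snd (x s)) t (snd d) H2) as [D3 D4].
  exact (conj D1 (conj D2 (conj D3 D4))).
Qed.

(** The polar equations at energy [1/2] are singular at [w = 0], and [J / w] is not
Lipschitz in [w] uniformly in [J].  Cutting [w] off below [om] and [J] outside
[-B <= J <= B] makes them globally Lipschitz without changing them on the orbits
of interest. *)
Definition truncated_field (alpha : R) (U dU : R -> R) (om B : R) (x : phase_space) : phase_space :=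
  state (2 * st_p x)
    (1 + (2 - alpha) * Rpower (Rmax om (st_w x)) (- alpha / 2) * U (st_th x))
    (clamp B (st_J x) / Rmax om (st_w x))
    (Rpower (Rmax om (st_w x)) (- alpha / 2) * dU (st_th x)).

Record admissible (U dU : R -> R) (m0 M0 M1 M2 : R) : Prop := {
  adm_m0 : 0 < m0;
  adm_U : forall x, m0 <= U x <= M0;
  adm_derive : forall x, is_derive U x (dU x);
  adm_dU : forall x, Rabs (dU x) <= M1;
  adm_lip : forall x y, Rabs (dU x - dU y) <= M2 * Rabs (x - y)
}.

Arguments adm_m0 {U dU m0 M0 M1 M2} _.
Arguments adm_U {U dU m0 M0 M1 M2} _ _.
Arguments adm_derive {U dU m0 M0 M1 M2} _ _.
Arguments adm_dU {U dU m0 M0 M1 M2} _ _.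

(** Up to the linear term [2 p], each component is a product of bounded Lipschitz
functions of single coordinates. *)
Lemma truncated_field_lipschitz (alpha : R) (U dU : R -> R) (m0 M0 M1 M2 om B : R) :
  0 < alpha <= 2 -> 0 < om -> 0 <= B -> admissible U dU m0 M0 M1 M2 ->
  exists K, 0 < K /\ forall x y,
    norm (minus (truncated_field alpha U dU om B x) (truncated_field alpha U dU om B y))
      <= K * norm (minus x y).
Proof.
  intros Ha Hom HB [Hm0 HU HdU HM1 HM2].
  assert (HM0 : 0 < M0) by (pose proof (HU 0); lra).
  assert (Lf : bounded_lipschitz (V := phase_space)
    (fun x => Rpower (Rmax om (st_w x)) (- alpha / 2))).
  { apply (bounded_lipschitz_comp (fun a => Rpower (Rmax om a) (- alpha / 2)) st_w
      (Rpower om (- alpha / 2)) (alpha / 2 * Rpower om (- alpha / 2 - 1))).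
    - intros a; rewrite Rabs_pos_eq by (left; apply exp_pos).
      apply Rpower_le_nonpos; [split; [lra | apply Rmax_l] | lra].
    - intros a b.
      apply Rle_trans with (alpha / 2 * Rpower om (- alpha / 2 - 1) * Rabs (Rmax om a - Rmax om b)).
      + apply (derive_bounded_lipschitz (fun z => Rpower z (- alpha / 2))
          (fun z => - alpha / 2 * Rpower z (- alpha / 2 - 1))).
        intros z Hz.
        assert (Hoz : om <= z).
        { apply Rle_trans with (2 := proj1 Hz); apply Rmin_glb; apply Rmax_l. }
        split.
        * apply is_derive_Reals, derivable_pt_lim_power; lra.
        * rewrite Rabs_mult, (Rabs_left1 (- alpha / 2)) by lra.
          rewrite Rabs_pos_eq by (left; apply exp_pos).
          replace (- (- alpha / 2)) with (alpha / 2) by field.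
          apply Rmult_le_compat_l; [lra|]. apply Rpower_le_nonpos; lra.
      + apply Rmult_le_compat_l; [|apply Rmax_lipschitz].
        apply Rmult_le_pos; [lra | left; apply exp_pos].
    - intros x y; apply norm_phase_ge. }
  assert (Li : bounded_lipschitz (V := phase_space) (fun x => / Rmax om (st_w x))).
  { apply (bounded_lipschitz_comp (fun a => / Rmax om a) st_w (/ om) (/ (om * om))).
    - intros a; pose proof (Rmax_l om a).
      rewrite Rabs_pos_eq by (left; apply Rinv_0_lt_compat; lra).
      apply Rinv_le_contravar; lra.
    - intros a b. pose proof (Rmax_l om a); pose proof (Rmax_l om b).
      pose proof (Rmax_lipschitz om a b) as Hl.
      set (x := Rmax om a) in *; set (y := Rmax om b) in *.
      replace (/ x - / y) with (/ (x * y) * (y - x)) by (field; lra).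
      rewrite Rabs_mult, Rabs_minus_sym, Rabs_pos_eq
        by (left; apply Rinv_0_lt_compat; nra).
      apply Rmult_le_compat; trivial; [left; apply Rinv_0_lt_compat; nra | apply Rabs_pos |].
      apply Rinv_le_contravar; nra.
    - intros x y; apply norm_phase_ge. }
  assert (LJ : bounded_lipschitz (V := phase_space) (fun x => clamp B (st_J x))).
  { apply (bounded_lipschitz_comp (clamp B) st_J B 1).
    - intros; now apply clamp_bounded.
    - intros a b; rewrite Rmult_1_l; apply clamp_lipschitz.
    - intros x y; apply norm_phase_ge. }
  assert (LU : bounded_lipschitz (V := phase_space) (fun x => U (st_th x))).
  { apply (bounded_lipschitz_comp U st_th M0 M1).
    - intros a; pose proof (HU a); rewrite Rabs_pos_eq; lra.
    - intros a b; apply derive_bounded_lipschitz with dU; auto.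
    - intros x y; apply norm_phase_ge. }
  assert (LdU : bounded_lipschitz (V := phase_space) (fun x => dU (st_th x))).
  { apply (bounded_lipschitz_comp dU st_th M1 M2); trivial.
    intros x y; apply norm_phase_ge. }
  destruct (bounded_lipschitz_mult _ _ Lf LU) as [K1 H1].
  destruct (bounded_lipschitz_mult _ _ LJ Li) as [K2 H2].
  destruct (bounded_lipschitz_mult _ _ Lf LdU) as [K3 H3].
  assert (P1 : 0 <= K1) by (destruct (H1 zero zero) as [E _]; apply Rle_trans with (2 := E), Rabs_pos).
  assert (P2 : 0 <= K2) by (destruct (H2 zero zero) as [E _]; apply Rle_trans with (2 := E), Rabs_pos).
  assert (P3 : 0 <= K3) by (destruct (H3 zero zero) as [E _]; apply Rle_trans with (2 := E), Rabs_pos).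
  exists (2 + 2 * K1 + K2 + K3); split; [lra|].
  intros x y. apply Rle_trans with (1 := norm_phase_le _ _).
  set (n := norm (minus x y)).
  assert (E1 := proj2 (H1 x y)); change (norm (minus x y)) with n in E1.
  assert (E2 := proj2 (H2 x y)); change (norm (minus x y)) with n in E2.
  assert (E3 := proj2 (H3 x y)); change (norm (minus x y)) with n in E3.
  assert (Hp := proj1 (proj2 (norm_phase_ge x y))); change (norm (minus x y)) with n in Hp.
  unfold truncated_field.
  change (st_w (state ?a ?b ?c ?d)) with a.
  change (st_p (state ?a ?b ?c ?d)) with b.
  change (st_th (state ?a ?b ?c ?d)) with c.
  change (st_J (state ?a ?b ?c ?d)) with d.
  assert (Q1 : Rabs (2 * st_p x - 2 * st_p y) <= 2 * n).
  { replace (_ - _) with (2 * (st_p x - st_p y)) by ring.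
    rewrite Rabs_mult, (Rabs_pos_eq 2) by lra; lra. }
  assert (Q2 : forall a b a' b', Rabs (a * b - a' * b') <= K1 * n ->
    Rabs (1 + (2 - alpha) * a * b - (1 + (2 - alpha) * a' * b')) <= 2 * (K1 * n)).
  { intros a b a' b' H.
    replace (_ - _) with ((2 - alpha) * (a * b - a' * b')) by ring.
    rewrite Rabs_mult, (Rabs_pos_eq (2 - alpha)) by lra.
    pose proof (Rabs_pos (a * b - a' * b')).
    apply Rmult_le_compat; lra. }
  specialize (Q2 _ _ _ _ E1). unfold Rdiv in *; lra.
Qed.

(** [w'' >= 2] and [w' (0) = 0]. *)
Lemma parabola_bound (w p q : R -> R) :
  (forall t, is_derive w t (2 * p t)) -> (forall t, is_derive p t (q t)) ->
  (forall t, 1 <= q t) -> p 0 = 0 ->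
  forall t, (0 <= t -> t <= p t) /\ (t <= 0 -> p t <= t) /\ w 0 + t * t <= w t.
Proof.
  intros Dw Dp Hq Hp0.
  assert (Dpt : forall t, is_derive (fun s => p s - s) t (q t - 1)).
  { intros t; apply (is_derive_minus p (fun s => s)); [apply Dp | apply (is_derive_id t)]. }
  assert (Dwt : forall t, is_derive (fun s => w s - s * s) t (2 * p t - 2 * t)).
  { intros t; apply (is_derive_minus w (fun s => s * s)); [apply Dw|].
    auto_derive; trivial; ring. }
  assert (Hp1 : forall t, 0 <= t -> t <= p t).
  { intros t Ht.
    pose proof (derive_nonneg_le (fun s => p s - s) (fun s => q s - 1) 0 t Ht) as H.
    cbv beta in H; rewrite Hp0 in H.
    enough (0 - 0 <= p t - t) by lra.
    apply H; intros x _; split; [apply Dpt | pose proof (Hq x); lra]. }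
  assert (Hp2 : forall t, t <= 0 -> p t <= t).
  { intros t Ht.
    pose proof (derive_nonneg_le (fun s => p s - s) (fun s => q s - 1) t 0 Ht) as H.
    cbv beta in H; rewrite Hp0 in H.
    enough (p t - t <= 0 - 0) by lra.
    apply H; intros x _; split; [apply Dpt | pose proof (Hq x); lra]. }
  intros t; split; [apply Hp1 | split; [apply Hp2|]].
  destruct (Rle_dec 0 t) as [Ht|Ht].
  - enough (w 0 - 0 * 0 <= w t - t * t) by lra.
    apply (derive_nonneg_le (fun s => w s - s * s) (fun s => 2 * p s - 2 * s)); trivial.
    intros x Hx; split; [apply Dwt | pose proof (Hp1 x (proj1 Hx)); lra].
  - enough (- (w t - t * t) <= - (w 0 - 0 * 0)) by lra.
    apply (derive_nonneg_le (fun s => - (w s - s * s)) (fun s => - (2 * p s - 2 * s))); [lra|].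
    intros x Hx; split; [apply (is_derive_opp (fun s => w s - s * s)), Dwt |
      pose proof (Hp2 x (proj2 Hx)); lra].
Qed.

(** The value of [J] that the energy relation imposes at the apex, where [p = 0],
taken with the positive sign. *)
Definition apex_momentum (alpha : R) (U : R -> R) (w0 th0 : R) : R :=
  sqrt (w0 + 2 * w0 * Rpower w0 (- alpha / 2) * U th0).

(** At the apex the distance to the origin is minimal; time is counted from there. *)
Record apex_solution (alpha : R) (U dU : R -> R) (w0 th0 : R) (w p th J : R -> R) : Prop := {
  apex_polar : polar_solution alpha U dU (/ 2) w p th J;
  apex_w : w 0 = w0;
  apex_p : p 0 = 0;
  apex_th : th 0 = th0;
  apex_J : J 0 = apex_momentum alpha U w0 th0
}.

Arguments apex_polar {alpha U dU w0 th0 w p th J} _.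
Arguments apex_w {alpha U dU w0 th0 w p th J} _.
Arguments apex_p {alpha U dU w0 th0 w p th J} _.
Arguments apex_th {alpha U dU w0 th0 w p th J} _.
Arguments apex_J {alpha U dU w0 th0 w p th J} _.

(** The energy relation is an integral of motion of the differential equations, so
it holds for all times as soon as it holds at the apex. *)
Lemma polar_energy_conserved (alpha : R) (U dU w p th J : R -> R) :
  (forall x, is_derive U x (dU x)) -> (forall t, 0 < w t) ->
  (forall t, is_derive w t (2 * p t)) ->
  (forall t, is_derive p t (1 + (2 - alpha) * Rpower (w t) (- alpha / 2) * U (th t))) ->
  (forall t, is_derive th t (J t / w t)) ->
  (forall t, is_derive J t (Rpower (w t) (- alpha / 2) * dU (th t))) ->
  let e t := p t * p t + J t * J t - w t - 2 * w t * Rpower (w t) (- alpha / 2) * U (th t) in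
  forall t, e t = e 0.
Proof.
  intros HU Hw Dw Dp Dth DJ e t.
  assert (De : forall s, is_derive e s 0).
  { intros s; unfold e, Rpower.
    specialize (Hw s); specialize (Dw s); specialize (Dp s); specialize (Dth s);
      specialize (DJ s); specialize (HU (th s)).
    assert (Xw : ex_derive w s) by (eexists; exact Dw).
    assert (Xp : ex_derive p s) by (eexists; exact Dp).
    assert (Xth : ex_derive th s) by (eexists; exact Dth).
    assert (XJ : ex_derive J s) by (eexists; exact DJ).
    assert (XU : ex_derive U (th s)) by (eexists; exact HU).
    apply is_derive_unique in Dw; apply is_derive_unique in Dp;
      apply is_derive_unique in Dth; apply is_derive_unique in DJ;
      apply is_derive_unique in HU.
    unfold Rpower in *.
    set (f := exp (- alpha / 2 * ln (w s))) in *.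
    change (Derive (fun x => w x) s = 2 * p s) in Dw.
    change (Derive (fun x => th x) s = J s / w s) in Dth.
    change (Derive (fun x => J x) s = f * dU (th s)) in DJ.
    change (Derive (fun x => p x) s = 1 + (2 - alpha) * f * U (th s)) in Dp.
    change (Derive (fun x => U x) (th s) = dU (th s)) in HU.
    auto_derive; [repeat split; trivial|].
    rewrite Dw, Dp, Dth, DJ, HU; fold f. change (- alpha * / 2) with (- alpha / 2).
    fold f. field. lra. }
  assert (H : Rabs (e t - e 0) <= 0 * Rabs (t - 0)).
  { apply derive_bounded_lipschitz with (fun _ => 0).
    intros z _; split; [apply De | rewrite Rabs_R0; lra]. }
  rewrite Rmult_0_l in H; pose proof (Rabs_pos (e t - e 0)).
  apply Rminus_diag_uniq; destruct (Req_dec (e t - e 0) 0) as [E|E]; trivial.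
  apply Rabs_pos_lt in E; lra.
Qed.

Lemma apex_momentum_square (alpha : R) (U dU : R -> R) (m0 M0 M1 M2 w0 th0 : R) :
  admissible U dU m0 M0 M1 M2 -> 0 < w0 ->
  apex_momentum alpha U w0 th0 * apex_momentum alpha U w0 th0 =
  w0 + 2 * w0 * Rpower w0 (- alpha / 2) * U th0.
Proof.
  intros HU Hw; apply sqrt_sqrt.
  pose proof (adm_U HU th0); pose proof (adm_m0 HU).
  assert (0 < Rpower w0 (- alpha / 2)) by apply exp_pos.
  apply Rplus_le_le_0_compat; [lra|].
  repeat apply Rmult_le_pos; lra.
Qed.

(** A priori bounds for the truncated equations.  The bound [w >= w0 + t^2] holds
there too, hence [w] stays above [om]; it makes [J'] integrable, and [J] varies by
at most [4 M1 / om], which is within the cut-off [B]. *)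
Lemma untruncate (alpha : R) (U dU : R -> R) (m0 M0 M1 M2 om B w0 th0 : R) (w p th J : R -> R) :
  3 / 2 <= alpha <= 2 -> 0 < om <= 1 -> admissible U dU m0 M0 M1 M2 -> om <= w0 ->
  apex_momentum alpha U w0 th0 + 4 * M1 / om <= B ->
  (forall t, is_derive w t (2 * p t)) ->
  (forall t, is_derive p t
     (1 + (2 - alpha) * Rpower (Rmax om (w t)) (- alpha / 2) * U (th t))) ->
  (forall t, is_derive th t (clamp B (J t) / Rmax om (w t))) ->
  (forall t, is_derive J t (Rpower (Rmax om (w t)) (- alpha / 2) * dU (th t))) ->
  w 0 = w0 -> p 0 = 0 -> th 0 = th0 -> J 0 = apex_momentum alpha U w0 th0 ->
  apex_solution alpha U dU w0 th0 w p th J /\ forall t, Rabs (J t) <= B.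
Proof.
  intros Ha Hom HU Hw0 HB Dw Dp Dth DJ E1 E2 E3 E4.
  assert (Hq : forall t, 1 <= 1 + (2 - alpha) * Rpower (Rmax om (w t)) (- alpha / 2) * U (th t)).
  { intros t.
    pose proof (adm_U HU (th t)); pose proof (adm_m0 HU).
    assert (0 < Rpower (Rmax om (w t)) (- alpha / 2)) by apply exp_pos.
    assert (0 <= (2 - alpha) * Rpower (Rmax om (w t)) (- alpha / 2) * U (th t))
      by (repeat apply Rmult_le_pos; lra).
    lra. }
  assert (Hw : forall t, w0 + t * t <= w t).
  { intros t; rewrite <- E1; apply (parabola_bound w p _ Dw Dp Hq E2 t). }
  assert (Hmax : forall t, Rmax om (w t) = w t).
  { intros t; apply Rmax_right; pose proof (Hw t); nra. }
  assert (HJ : forall t, Rabs (J t) <= B).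
  { intros t.
    assert (HJ0 : Rabs (J t - J 0) <= 2 * (M1 * (2 / om))).
    { apply decay_bounded with (fun t => Rpower (Rmax om (w t)) (- alpha / 2) * dU (th t)).
      intros x; split; [apply DJ|].
      rewrite Hmax, Rabs_mult, Rabs_pos_eq by (left; apply exp_pos).
      rewrite Rmult_comm, Rmult_assoc.
      apply Rmult_le_compat; [apply Rabs_pos | left; apply exp_pos | apply HU |].
      apply decay_Rpower_le; trivial.
      pose proof (Hw x); nra. }
    rewrite E4 in HJ0.
    replace (J t) with ((J t - apex_momentum alpha U w0 th0) + apex_momentum alpha U w0 th0) by ring.
    apply Rle_trans with (1 := Rabs_triang _ _).
    rewrite (Rabs_pos_eq (apex_momentum alpha U w0 th0)) by apply sqrt_pos.
    unfold Rdiv in *; lra. }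
  split; [|exact HJ].
  split; trivial.
  assert (Dp' : forall t,
    is_derive p t (1 + (2 - alpha) * Rpower (w t) (- alpha / 2) * U (th t)))
    by (intros t; rewrite <- (Hmax t) at 1; apply Dp).
  assert (Dth' : forall t, is_derive th t (J t / w t))
    by (intros t; rewrite <- (Hmax t), <- (clamp_id B (J t)) at 1 by apply HJ; apply Dth).
  assert (DJ' : forall t, is_derive J t (Rpower (w t) (- alpha / 2) * dU (th t)))
    by (intros t; rewrite <- (Hmax t) at 1; apply DJ).
  assert (Hpos : forall t, 0 < w t) by (intros t; pose proof (Hw t); nra).
  split; trivial.
  - intros t; replace (2 * / 2) with 1 by field; apply Dp'.
  - intros t.
    pose proof (polar_energy_conserved alpha U dU w p th J (adm_derive HU)
      Hpos Dw Dp' Dth' DJ' t) as He.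
    cbv beta zeta in He; rewrite E1, E2, E3, E4 in He.
    rewrite (apex_momentum_square alpha U dU m0 M0 M1 M2) in He by (trivial; lra).
    lra.
Qed.

Lemma continuous2_at_continuous (f : R -> R -> R) (x y : R) :
  continuous (T := prod_UniformSpace R_UniformSpace R_UniformSpace)
    (fun z => f (fst z) (snd z)) (x, y) ->
  continuous2_at f x y.
Proof.
  intros H eps He.
  destruct (H (fun r => Rabs (r - f x y) < eps)) as [d Hd].
  { exists (mkposreal eps He); intros r Hr; exact Hr. }
  exists d; split; [apply cond_pos|].
  intros x' y' Hx Hy; apply (Hd (x', y')); split; [exact Hx | exact Hy].
Qed.

Lemma apex_momentum_continuous (alpha : R) (U dU : R -> R) (m0 M0 M1 M2 w0 th0 : R) :
  admissible U dU m0 M0 M1 M2 -> 0 < w0 -> continuous2_at (apex_momentum alpha U) w0 th0.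
Proof.
  intros HU Hw; apply continuous2_at_continuous.
  apply (continuous_comp
    (fun z : prod_UniformSpace R_UniformSpace R_UniformSpace =>
       fst z + 2 * fst z * Rpower (fst z) (- alpha / 2) * U (snd z)) sqrt).
  - apply (continuous_plus (V := R_NormedModule) (fun z => fst z)); [apply continuous_fst|].
    apply (continuous_mult (fun z => 2 * fst z * Rpower (fst z) (- alpha / 2))
      (fun z => U (snd z))).
    + apply (continuous_comp (fun z => fst z) (fun w => 2 * w * Rpower w (- alpha / 2)));
        [apply continuous_fst|].
      apply (ex_derive_continuous (V := R_NormedModule)); unfold Rpower; auto_derive; simpl; lra.
    + apply (continuous_comp (fun z => snd z) U); [apply continuous_snd|].
      apply (ex_derive_continuous (V := R_NormedModule)); eexists; apply HU.
  - apply continuity_pt_filterlim, continuity_pt_sqrt; simpl.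
    pose proof (adm_U HU th0); pose proof (adm_m0 HU).
    assert (0 < Rpower w0 (- alpha / 2)) by apply exp_pos.
    apply Rplus_le_le_0_compat; [lra | repeat apply Rmult_le_pos; lra].
Qed.

(** The limits of the angle inherit continuity in the initial data from the angle at
finite times, because the tails are uniformly small. *)
Lemma continuous2_at_uniform_limit (T : R -> R -> R -> R) (L : R -> R -> R) (om Om K : R) :
  (forall a b t, om < a < Om -> 0 <= t -> Rabs (L a b - T a b t) <= K / sqrt (1 + t)) ->
  (forall a b t, om < a < Om -> continuous2_at (fun a b => T a b t) a b) ->
  forall a b, om < a < Om -> continuous2_at L a b.
Proof.
  intros HL HT a b Ha eps He.
  set (q := 3 * Rabs K / eps).
  assert (Hq : 0 <= q).
  { apply Rmult_le_pos; [pose proof (Rabs_pos K); lra | left; now apply Rinv_0_lt_compat]. }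
  set (t := (q + 1) * (q + 1)).
  assert (Hs : q + 1 <= sqrt (1 + t)).
  { rewrite <- (sqrt_square (q + 1)) at 1 by lra. apply sqrt_le_1_alt; unfold t; lra. }
  assert (Ht : 0 <= t) by (unfold t; nra).
  assert (HK : K / sqrt (1 + t) < eps / 3).
  { apply Rmult_lt_reg_r with (sqrt (1 + t)); [lra|].
    unfold Rdiv at 1; rewrite Rmult_assoc, Rinv_l, Rmult_1_r by lra.
    apply Rle_lt_trans with (1 := Rle_abs K).
    replace (Rabs K) with (eps / 3 * q) by (unfold q; field; lra). nra. }
  destruct (HT a b t Ha (eps / 3) ltac:(lra)) as [d [Hd Hc]].
  exists (Rmin d (Rmin (a - om) (Om - a))); split.
  - repeat apply Rmin_pos; lra.
  - intros x y Hx Hy.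
    assert (Hxd : Rabs (x - a) < d) by (apply Rlt_le_trans with (1 := Hx); apply Rmin_l).
    assert (Hyd : Rabs (y - b) < d) by (apply Rlt_le_trans with (1 := Hy); apply Rmin_l).
    assert (Hx' : om < x < Om).
    { assert (H1 : Rabs (x - a) < Rmin (a - om) (Om - a))
        by (apply Rlt_le_trans with (1 := Hx); apply Rmin_r).
      pose proof (Rmin_l (a - om) (Om - a)); pose proof (Rmin_r (a - om) (Om - a)).
      apply Rabs_def2 in H1; lra. }
    specialize (Hc x y Hxd Hyd).
    pose proof (HL x y t Hx' Ht) as H1; pose proof (HL a b t Ha Ht) as H2.
    replace (L x y - L a b) with
      ((L x y - T x y t) + (T x y t - T a b t) - (L a b - T a b t)) by ring.
    apply Rle_lt_trans with (1 := Rabs_triang _ _); rewrite Rabs_Ropp.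
    pose proof (Rabs_triang (L x y - T x y t) (T x y t - T a b t)); lra.
Qed.

Lemma is_lim_reflect (y : R -> R) (l : R) :
  is_lim (fun t => y (- t)) p_infty l -> is_lim y m_infty l.
Proof.
  intros H P HP; destruct (H P HP) as [M HM]; exists (- M).
  intros x Hx; rewrite <- (Ropp_involutive x); apply HM; lra.
Qed.

(** The interval of initial values [om <= w0 <= Om] is fixed first, since the
truncation has to be the same for the whole family in order that the flow depend
continuously on the data. *)
Lemma apex_trajectories (alpha : R) (U dU : R -> R) (m0 M0 M1 M2 om Om : R) :
  3 / 2 <= alpha <= 2 -> 0 < om <= 1 -> admissible U dU m0 M0 M1 M2 ->
  exists (W P T J : R -> R -> R -> R) (B : R),
    (forall w0 th0, om <= w0 <= Om ->
      apex_solution alpha U dU w0 th0 (W w0 th0) (P w0 th0) (T w0 th0) (J w0 th0) /\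
      forall t, Rabs (J w0 th0 t) <= B) /\
    (forall w0 th0 t, 0 < w0 -> continuous2_at (fun a b => T a b t) w0 th0).
Proof.
  intros Ha Hom HU.
  set (B := sqrt (Om + 2 * Om * Rpower om (- alpha / 2) * M0) + 4 * M1 / om).
  assert (HM1 : 0 <= M1)
    by (apply Rle_trans with (2 := adm_dU HU 0), Rabs_pos).
  assert (HB : 0 <= B).
  { apply Rplus_le_le_0_compat; [apply sqrt_pos|].
    apply Rmult_le_pos; [lra | left; apply Rinv_0_lt_compat; lra]. }
  destruct (truncated_field_lipschitz alpha U dU m0 M0 M1 M2 om B) as [K [HK HF]];
    trivial; try lra.
  set (F := truncated_field alpha U dU om B) in *.
  set (x0 := fun w0 th0 => state w0 0 th0 (apex_momentum alpha U w0 th0)).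
  set (X := fun w0 th0 => flow F (x0 w0 th0)).
  exists (fun w0 th0 t => st_w (X w0 th0 t)), (fun w0 th0 t => st_p (X w0 th0 t)),
    (fun w0 th0 t => st_th (X w0 th0 t)), (fun w0 th0 t => st_J (X w0 th0 t)), B.
  split.
  - intros w0 th0 Hw0.
    assert (D : forall t, is_derive (X w0 th0) t (F (X w0 th0 t)))
      by (intros t; apply (flow_derive F K HK HF)).
    assert (E0 : X w0 th0 0 = x0 w0 th0) by apply (flow_0 F K HK HF).
    apply (untruncate alpha U dU m0 M0 M1 M2 om B); trivial; try lra.
    + apply Rplus_le_compat_r, sqrt_le_1_alt.
      pose proof (adm_U HU th0); pose proof (adm_m0 HU).
      apply Rplus_le_compat; [lra|].
      assert (Hf : 0 < Rpower w0 (- alpha / 2)) by apply exp_pos.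
      assert (Hfo : Rpower w0 (- alpha / 2) <= Rpower om (- alpha / 2))
        by (apply Rpower_le_nonpos; lra).
      apply Rmult_le_compat; try lra.
      * apply Rmult_le_pos; lra.
      * apply Rmult_le_compat; lra.
    + intros t; apply (is_derive_phase _ _ _ (D t)).
    + intros t; apply (is_derive_phase _ _ _ (D t)).
    + intros t; apply (is_derive_phase _ _ _ (D t)).
    + intros t; apply (is_derive_phase _ _ _ (D t)).
    + now rewrite E0.
    + now rewrite E0.
    + now rewrite E0.
    + now rewrite E0.
  - intros w0 th0 t Hw0 eps He.
    set (E := exp (K * Rabs t)).
    assert (HE : 0 < E) by apply exp_pos.
    destruct (apex_momentum_continuous alpha U dU m0 M0 M1 M2 w0 th0 HU Hw0 (eps / (3 * E)))
      as [d [Hd Hc]]; [apply Rdiv_lt_0_compat; lra|].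
    exists (Rmin d (eps / (3 * E))); split.
    + apply Rmin_pos; trivial. apply Rdiv_lt_0_compat; lra.
    + intros a b Ha1 Hb1.
      pose proof (Rmin_l d (eps / (3 * E))); pose proof (Rmin_r d (eps / (3 * E))).
      specialize (Hc a b ltac:(lra) ltac:(lra)).
      assert (H1 := proj1 (proj2 (proj2 (norm_phase_ge (X a b t) (X w0 th0 t))))).
      assert (H2 : norm (minus (X a b t) (X w0 th0 t)) <=
        norm (minus (x0 a b) (x0 w0 th0)) * E)
        by apply (flow_initial_value F K HK HF).
      assert (H3 := norm_phase_le (x0 a b) (x0 w0 th0)).
      change (norm (minus (x0 a b) (x0 w0 th0)) <= Rabs (a - w0) + Rabs (0 - 0) +
        Rabs (b - th0) + Rabs (apex_momentum alpha U a b - apex_momentum alpha U w0 th0)) in H3.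
      rewrite Rminus_0_r, Rabs_R0 in H3.
      apply Rle_lt_trans with (1 := H1). apply Rle_lt_trans with (1 := H2).
      replace eps with ((3 * (eps / (3 * E))) * E) by (field; lra).
      apply Rmult_lt_compat_r; trivial.
      apply Rle_lt_trans with (1 := H3). lra.
Qed.

Lemma apex_lower_bound (alpha : R) (U dU : R -> R) (m0 M0 M1 M2 w0 th0 : R) (w p th J : R -> R) :
  alpha <= 2 -> admissible U dU m0 M0 M1 M2 -> apex_solution alpha U dU w0 th0 w p th J ->
  forall t, (0 <= t -> t <= p t) /\ (t <= 0 -> p t <= t) /\ w0 + t * t <= w t.
Proof.
  intros Ha HU [Hs E1 E2 _ _] t. rewrite <- E1.
  apply (parabola_bound w p _ (polar_w Hs) (polar_p Hs)); trivial.
  intros s.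
  pose proof (adm_U HU (th s)); pose proof (adm_m0 HU).
  assert (0 < Rpower (w s) (- alpha / 2)) by apply exp_pos.
  assert (0 <= (2 - alpha) * Rpower (w s) (- alpha / 2) * U (th s))
    by (repeat apply Rmult_le_pos; lra).
  lra.
Qed.

Arguments apex_lower_bound {alpha U dU m0 M0 M1 M2 w0 th0 w p th J} _ _ _ _.

Lemma apex_angle_decay (alpha : R) (U dU : R -> R) (m0 M0 M1 M2 om B w0 th0 : R) (w p th J : R -> R) :
  alpha <= 2 -> 0 < om <= 1 -> om <= w0 -> admissible U dU m0 M0 M1 M2 ->
  apex_solution alpha U dU w0 th0 w p th J -> (forall t, Rabs (J t) <= B) ->
  forall t, is_derive th t (J t / w t) /\ Rabs (J t / w t) <= B * (2 / om) * decay t.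
Proof.
  intros Ha Hom Hw0 HU Hs HJ t; split; [apply Hs|].
  pose proof (proj2 (proj2 (apex_lower_bound Ha HU Hs t))) as Hw.
  assert (Hlow : om * (1 + t * t) <= w t) by nra.
  assert (0 < om * (1 + t * t)) by nra.
  unfold Rdiv at 1; rewrite Rabs_mult, Rmult_assoc.
  apply Rmult_le_compat; try apply Rabs_pos; trivial.
  rewrite Rabs_pos_eq by (left; apply Rinv_0_lt_compat; lra).
  apply Rle_trans with (2 := decay_inv_le om t ltac:(lra)).
  apply Rinv_le_contravar; trivial.
Qed.

Lemma apex_family (alpha : R) (U dU : R -> R) (m0 M0 M1 M2 om Om : R) :
  3 / 2 <= alpha <= 2 -> 0 < om <= 1 -> admissible U dU m0 M0 M1 M2 ->
  exists (W P T J : R -> R -> R -> R) (Tm Tp : R -> R -> R) (C : R),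
    (forall w0 th0, om <= w0 <= Om ->
      apex_solution alpha U dU w0 th0 (W w0 th0) (P w0 th0) (T w0 th0) (J w0 th0) /\
      is_lim (T w0 th0) m_infty (Tm w0 th0) /\ is_lim (T w0 th0) p_infty (Tp w0 th0) /\
      Rabs (Tm w0 th0 - th0) <= C) /\
    (forall w0 th0, om < w0 < Om -> continuous2_at Tm w0 th0 /\ continuous2_at Tp w0 th0).
Proof.
  intros Ha Hom HU.
  destruct (apex_trajectories alpha U dU m0 M0 M1 M2 om Om Ha Hom HU)
    as [W [P [T [J [B [HS HC]]]]]].
  set (K := B * (2 / om)).
  assert (Hdec : forall w0 th0, om <= w0 <= Om -> forall t,
    is_derive (T w0 th0) t (J w0 th0 t / W w0 th0 t) /\
    Rabs (J w0 th0 t / W w0 th0 t) <= K * decay t).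
  { intros w0 th0 Hw0; destruct (HS w0 th0 Hw0) as [H1 H2].
    apply (apex_angle_decay alpha U dU m0 M0 M1 M2 om B w0 th0 _ (P w0 th0)); trivial; lra. }
  assert (Hdec' : forall w0 th0, om <= w0 <= Om -> forall t,
    is_derive (fun s => T w0 th0 (- s)) t (- (J w0 th0 (- t) / W w0 th0 (- t))) /\
    Rabs (- (J w0 th0 (- t) / W w0 th0 (- t))) <= K * decay t).
  { intros w0 th0 Hw0 t; destruct (Hdec w0 th0 Hw0 (- t)) as [D1 D2]; split.
    - now apply is_derive_reflect.
    - unfold decay in *; rewrite Rabs_Ropp in D2; rewrite Rabs_Ropp; exact D2. }
  set (Tp := fun w0 th0 => real (Lim (T w0 th0) p_infty)).
  set (Tm := fun w0 th0 => real (Lim (fun s => T w0 th0 (- s)) p_infty)).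
  assert (Hp : forall w0 th0, om <= w0 <= Om ->
    is_lim (T w0 th0) p_infty (Tp w0 th0) /\
    forall t, 0 <= t -> Rabs (Tp w0 th0 - T w0 th0 t) <= 2 * K / sqrt (1 + t)).
  { intros w0 th0 Hw0.
    destruct (decay_limit _ _ K (Hdec w0 th0 Hw0)) as [l [Hl1 Hl2]].
    assert (E : Tp w0 th0 = l) by exact (f_equal real (is_lim_unique _ _ _ Hl1)).
    rewrite E; now split. }
  assert (Hm : forall w0 th0, om <= w0 <= Om ->
    is_lim (fun s => T w0 th0 (- s)) p_infty (Tm w0 th0) /\
    forall t, 0 <= t -> Rabs (Tm w0 th0 - T w0 th0 (- t)) <= 2 * K / sqrt (1 + t)).
  { intros w0 th0 Hw0.
    destruct (decay_limit _ _ K (Hdec' w0 th0 Hw0)) as [l [Hl1 Hl2]].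
    assert (E : Tm w0 th0 = l) by exact (f_equal real (is_lim_unique _ _ _ Hl1)).
    rewrite E; now split. }
  exists W, P, T, J, Tm, Tp, (2 * K); split.
  - intros w0 th0 Hw0; destruct (HS w0 th0 Hw0) as [H1 H2]; split; [|split; [|split]]; trivial.
    + apply is_lim_reflect, Hm, Hw0.
    + apply Hp, Hw0.
    + pose proof (proj2 (Hm w0 th0 Hw0) 0 ltac:(lra)) as H.
      rewrite Ropp_0, (apex_th H1), Rplus_0_r, sqrt_1 in H.
      unfold Rdiv in H; rewrite Rinv_1, Rmult_1_r in H; exact H.
  - intros w0 th0 Hw0; split.
    + apply (continuous2_at_uniform_limit (fun a b t => T a b (- t)) Tm om Om (2 * K)); trivial.
      * intros a b t Hab Ht; apply Hm; trivial; lra.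
      * intros a b t Hab; apply HC; lra.
    + apply (continuous2_at_uniform_limit T Tp om Om (2 * K)); trivial.
      * intros a b t Hab Ht; apply Hp; trivial; lra.
      * intros a b t Hab; apply HC; lra.
Qed.

(** * Bounds on the deflection angle *)

Lemma admissible_reflect (U dU : R -> R) (m0 M0 M1 M2 : R) :
  admissible U dU m0 M0 M1 M2 ->
  admissible (fun x => U (- x)) (fun x => - dU (- x)) m0 M0 M1 M2.
Proof.
  intros [H1 H2 H3 H4 H5]; split; trivial.
  - intros x; apply is_derive_reflect, H3.
  - intros x; rewrite Rabs_Ropp; apply H4.
  - intros x y. replace (- dU (- x) - - dU (- y)) with (- (dU (- x) - dU (- y))) by ring.
    rewrite Rabs_Ropp; apply Rle_trans with (1 := H5 _ _).
    replace (- x - - y) with (- (x - y)) by ring; rewrite Rabs_Ropp; lra.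
Qed.

Arguments admissible_reflect {U dU m0 M0 M1 M2} _.

(** The symmetry [t -> -t], [th -> -th], under which [J] keeps its sign.  It exchanges
the two ends of a trajectory, so that estimates are needed for positive times
only. *)
Lemma apex_reflect (alpha : R) (U dU : R -> R) (w0 th0 : R) (w p th J : R -> R) :
  apex_solution alpha U dU w0 th0 w p th J ->
  apex_solution alpha (fun x => U (- x)) (fun x => - dU (- x)) w0 (- th0)
    (fun t => w (- t)) (fun t => - p (- t)) (fun t => - th (- t)) (fun t => J (- t)).
Proof.
  intros [[Hw Dw Dp Dth DJ He] E1 E2 E3 E4].
  assert (Dneg : forall (y : R -> R) d t, is_derive y (- t) d ->
    is_derive (fun s => - y (- s)) t d).
  { intros y d t Hy; rewrite <- (Ropp_involutive d).
    apply (is_derive_opp (fun s => y (- s))), is_derive_reflect, Hy. }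
  split; [split|..].
  - intros t; apply Hw.
  - intros t; replace (2 * - p (- t)) with (- (2 * p (- t))) by ring.
    apply is_derive_reflect, Dw.
  - intros t; rewrite Ropp_involutive; apply Dneg, Dp.
  - intros t; apply Dneg, Dth.
  - intros t; rewrite Ropp_involutive, Ropp_mult_distr_r_reverse.
    apply is_derive_reflect, DJ.
  - intros t; rewrite Ropp_involutive, Rmult_opp_opp; apply He.
  - now rewrite Ropp_0.
  - now rewrite Ropp_0, E2, Ropp_0.
  - now rewrite Ropp_0, E3.
  - rewrite Ropp_0, E4; unfold apex_momentum; now rewrite Ropp_involutive.
Qed.

Arguments apex_reflect {alpha U dU w0 th0 w p th J} _.

Lemma is_lim_reflect_opp (y : R -> R) (l : R) :
  is_lim y m_infty l -> is_lim (fun t => - y (- t)) p_infty (- l).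
Proof.
  intros H. apply (is_lim_opp (fun t => y (- t)) p_infty l).
  intros P HP; destruct (H P HP) as [M HM]; exists (- M).
  intros x Hx; apply HM; lra.
Qed.

Arguments is_lim_reflect_opp {y l} _.

Lemma is_derive_atan_scaled (w0 t : R) :
  0 < w0 -> is_derive (fun s => atan (s / sqrt w0) / sqrt w0) t (/ (w0 + t * t)).
Proof.
  intros Hw.
  assert (HS : 0 < sqrt w0) by now apply sqrt_lt_R0.
  assert (HSS : sqrt w0 * sqrt w0 = w0) by (apply sqrt_sqrt; lra).
  auto_derive; [trivial|].
  set (S := sqrt w0) in *; rewrite <- HSS. field. split; nra.
Qed.

Lemma is_lim_le_eventually (y : R -> R) (l c : R) :
  is_lim y p_infty l -> (forall t, 0 <= t -> y t <= c) -> l <= c.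
Proof.
  intros H Hc.
  apply (is_lim_le_loc y (fun _ => c) p_infty l c); trivial.
  - exists 0; intros x Hx; apply Hc; lra.
  - apply is_lim_const.
Qed.

Lemma Rmult_Rpower_id (x a : R) : 0 < x -> x * Rpower x (- a / 2) = Rpower x (1 - a / 2).
Proof.
  intros Hx; rewrite <- (Rpower_1 x) at 1 by trivial.
  rewrite <- Rpower_plus; f_equal; field.
Qed.

(** The momentum exceeds [sqrt w0] by at most [M0] at the apex, by the energy
relation, and by [4 M1] more later; and [sqrt w0 / (w0 + t^2)] has integral
[PI / 2] over the half-line. *)
Lemma half_angle_upper (alpha : R) (U dU : R -> R) (m0 M0 M1 M2 w0 th0 l : R) (w p th J : R -> R) :
  3 / 2 <= alpha <= 2 -> 1 <= w0 -> admissible U dU m0 M0 M1 M2 ->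
  apex_solution alpha U dU w0 th0 w p th J -> is_lim th p_infty l ->
  l - th0 <= (1 + (M0 + 4 * M1) / sqrt w0) * (PI / 2).
Proof.
  intros Ha Hw0 HU Hs Hl.
  pose proof (adm_U HU th0) as HU0; pose proof (adm_m0 HU) as Hm0.
  assert (HS : 1 <= sqrt w0) by (rewrite <- sqrt_1; apply sqrt_le_1_alt; lra).
  assert (HSS : sqrt w0 * sqrt w0 = w0) by (apply sqrt_sqrt; lra).
  assert (HJ0 : apex_momentum alpha U w0 th0 <= sqrt w0 + M0).
  { rewrite <- (sqrt_square (sqrt w0 + M0)) by lra.
    apply sqrt_le_1_alt.
    assert (Hf : w0 * Rpower w0 (- alpha / 2) <= sqrt w0).
    { rewrite Rmult_Rpower_id, <- (Rpower_sqrt w0) by lra.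
      destruct (Req_dec w0 1) as [->|Hn]; [unfold Rpower; rewrite ln_1, !Rmult_0_r; lra|].
      apply Rle_Rpower; lra. }
    assert (0 < w0 * Rpower w0 (- alpha / 2))
      by (apply Rmult_lt_0_compat; [lra | apply exp_pos]).
    assert (w0 * Rpower w0 (- alpha / 2) * U th0 <= sqrt w0 * M0)
      by (apply Rmult_le_compat; lra).
    nra. }
  assert (HJ : forall t, J t <= sqrt w0 + M0 + 4 * M1).
  { intros t.
    assert (H : Rabs (J t - J 0) <= 2 * (M1 * (2 / 1))).
    { apply decay_bounded with (fun t => Rpower (w t) (- alpha / 2) * dU (th t)).
      intros x; split; [apply Hs|].
      rewrite Rabs_mult, Rabs_pos_eq by (left; apply exp_pos).
      rewrite Rmult_comm, Rmult_assoc.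
      apply Rmult_le_compat; [apply Rabs_pos | left; apply exp_pos | apply HU |].
      apply decay_Rpower_le; trivial; [lra|].
      pose proof (proj2 (proj2 (apex_lower_bound (proj2 Ha) HU Hs x))); lra. }
    rewrite (apex_J Hs) in H.
    pose proof (Rle_abs (J t - apex_momentum alpha U w0 th0)); lra. }
  set (Jm := sqrt w0 + M0 + 4 * M1) in *.
  assert (HM1 : 0 <= M1)
    by (apply Rle_trans with (2 := adm_dU HU 0), Rabs_pos).
  replace ((1 + (M0 + 4 * M1) / sqrt w0) * (PI / 2)) with (Jm * ((PI / 2) / sqrt w0))
    by (unfold Jm; field; lra).
  cut (l <= th0 + Jm * ((PI / 2) / sqrt w0)); [lra|].
  apply (is_lim_le_eventually th l _ Hl).
  intros t Ht.
  assert (H : Jm * (atan (0 / sqrt w0) / sqrt w0) - th 0 <=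
              Jm * (atan (t / sqrt w0) / sqrt w0) - th t).
  { apply (derive_nonneg_le (fun t => Jm * (atan (t / sqrt w0) / sqrt w0) - th t)
      (fun t => Jm * / (w0 + t * t) - J t / w t)); trivial.
    intros x _; split.
    - apply (is_derive_minus (fun t => Jm * (atan (t / sqrt w0) / sqrt w0)) th);
        [apply is_derive_scal, is_derive_atan_scaled; lra | apply Hs].
    - pose proof (proj2 (proj2 (apex_lower_bound (proj2 Ha) HU Hs x))) as Hw.
      assert (0 < w0 + x * x) by nra.
      assert (J x / w x <= Jm * / w x)
        by (apply Rmult_le_compat_r; [left; apply Rinv_0_lt_compat; lra | apply HJ]).
      assert (Jm * / w x <= Jm * / (w0 + x * x)).
      { apply Rmult_le_compat_l; [unfold Jm; lra | apply Rinv_le_contravar; lra]. }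
      lra. }
  replace (0 / sqrt w0) with 0 in H by (field; lra).
  rewrite atan_0, (apex_th Hs) in H.
  pose proof (proj2 (atan_bound (t / sqrt w0))) as Hat.
  assert (Jm * (atan (t / sqrt w0) / sqrt w0) <= Jm * (PI / 2 / sqrt w0)).
  { apply Rmult_le_compat_l; [unfold Jm; lra|].
    apply Rmult_le_compat_r; [left; apply Rinv_0_lt_compat; lra | lra]. }
  unfold Rdiv in *; lra.
Qed.

(** Direct integration of [J'] would lose control as [w0] tends to [0], so [J] is bounded
through the energy relation: [p^2 - w] has derivative [2 U (w^{1 - alpha/2})'],
which for positive times is at most [2 M0 (w^{1 - alpha/2})'].  The estimate loses
only [2 M0] times the variation of [w^{1 - alpha/2}], and this tends to [0] on
bounded times as [alpha] tends to [2]. *)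
Lemma apex_momentum_lower (alpha : R) (U dU : R -> R) (m0 M0 M1 M2 w0 th0 : R) (w p th J : R -> R) (t : R) :
  alpha <= 2 -> 0 < w0 -> admissible U dU m0 M0 M1 M2 ->
  apex_solution alpha U dU w0 th0 w p th J -> 0 <= t ->
  w0 + 2 * m0 * Rpower (w t) (1 - alpha / 2)
    - 2 * M0 * (Rpower (w t) (1 - alpha / 2) - Rpower w0 (1 - alpha / 2)) <= J t * J t.
Proof.
  intros Ha Hw0 HU Hs Ht.
  pose proof (apex_polar Hs) as [Hw Dw Dp _ _ He].
  assert (H : - (p 0 * p 0 - w 0 - 2 * M0 * Rpower (w 0) (1 - alpha / 2)) <=
              - (p t * p t - w t - 2 * M0 * Rpower (w t) (1 - alpha / 2))).
  { apply (derive_nonneg_le (fun t => - (p t * p t - w t - 2 * M0 * Rpower (w t) (1 - alpha / 2)))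
      (fun t => 2 * (2 - alpha) * p t * Rpower (w t) (- alpha / 2) * (M0 - U (th t)))); trivial.
    intros x Hx; split.
    - specialize (Hw x); specialize (Dw x); specialize (Dp x).
      assert (Xw : ex_derive w x) by (eexists; exact Dw).
      assert (Xp : ex_derive p x) by (eexists; exact Dp).
      apply is_derive_unique in Dw; apply is_derive_unique in Dp.
      assert (Ef : exp ((1 - alpha / 2) * ln (w x)) = w x * Rpower (w x) (- alpha / 2))
        by (symmetry; apply Rmult_Rpower_id; trivial).
      set (f := Rpower (w x) (- alpha / 2)) in *.
      change (Derive (fun x => w x) x = 2 * p x) in Dw.
      change (Derive (fun x => p x) x = 2 * / 2 + (2 - alpha) * f * U (th x)) in Dp.
      unfold Rpower; auto_derive; [repeat split; trivial|].
      rewrite Dw, Dp. change (alpha * / 2) with (alpha / 2).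
      replace (1 + - (alpha / 2)) with (1 - alpha / 2) by ring.
      rewrite Ef; field; lra.
    - pose proof (proj1 (apex_lower_bound Ha HU Hs x) (proj1 Hx)).
      pose proof (adm_U HU (th x)).
      assert (0 < Rpower (w x) (- alpha / 2)) by apply exp_pos.
      repeat apply Rmult_le_pos; lra. }
  rewrite (apex_p Hs), (apex_w Hs) in H.
  specialize (He t); specialize (Hw t).
  rewrite (Rmult_assoc 2 (w t)), Rmult_Rpower_id in He by trivial.
  pose proof (adm_U HU (th t)).
  assert (0 < Rpower (w t) (1 - alpha / 2)) by apply exp_pos.
  assert (Rpower (w t) (1 - alpha / 2) * m0 <= Rpower (w t) (1 - alpha / 2) * U (th t))
    by (apply Rmult_le_compat_l; lra).
  lra.
Qed.

Arguments apex_momentum_lower {alpha U dU m0 M0 M1 M2 w0 th0 w p th J} _ _ _ _ _ _.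

(** For [alpha] close to [2], depending on [w0], the derivative of [p] stays below
[2]. *)
Lemma apex_upper_bound (alpha : R) (U dU : R -> R) (m0 M0 M1 M2 w0 th0 : R) (w p th J : R -> R) (t : R) :
  0 < alpha <= 2 -> 0 < w0 <= 1 -> (2 - alpha) * M0 <= w0 -> admissible U dU m0 M0 M1 M2 ->
  apex_solution alpha U dU w0 th0 w p th J -> 0 <= t -> w t <= w0 + 2 * (t * t).
Proof.
  intros Ha Hw0 HM HU Hs Ht.
  pose proof (apex_polar Hs) as [Hw Dw Dp _ _ _].
  assert (Hq : forall x, (2 - alpha) * Rpower (w x) (- alpha / 2) * U (th x) <= 1).
  { intros x.
    pose proof (proj2 (proj2 (apex_lower_bound (proj2 Ha) HU Hs x))) as Hl.
    pose proof (adm_U HU (th x)); pose proof (adm_m0 HU).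
    assert (Hf : Rpower (w x) (- alpha / 2) <= / w0).
    { apply Rle_trans with (Rpower w0 (- alpha / 2)).
      - apply Rpower_le_nonpos; [split; nra | lra].
      - rewrite <- (Rpower_1 w0) at 2 by lra. rewrite <- Rpower_Ropp.
        unfold Rpower.
        assert (Hln : ln w0 <= 0).
        { destruct (proj2 Hw0) as [H1|H1]; [|rewrite H1, ln_1; lra].
          left; rewrite <- ln_1; apply ln_increasing; lra. }
        destruct (Req_dec (- alpha / 2 * ln w0) (- (1) * ln w0)) as [->|Hn]; [lra|].
        left; apply exp_increasing; nra. }
    assert (0 < Rpower (w x) (- alpha / 2)) by apply exp_pos.
    apply Rle_trans with ((2 - alpha) * / w0 * M0).
    - apply Rmult_le_compat; try lra.
      + apply Rmult_le_pos; lra.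
      + apply Rmult_le_compat_l; lra.
    - apply Rmult_le_reg_r with w0; [lra|].
      replace ((2 - alpha) * / w0 * M0 * w0) with ((2 - alpha) * M0) by (field; lra). lra. }
  assert (Hp : forall s, 0 <= s -> p s <= 2 * s).
  { intros s Hs0.
    assert (H : 2 * 0 - p 0 <= 2 * s - p s).
    { apply (derive_nonneg_le (fun s => 2 * s - p s)
        (fun s => 2 - (2 * / 2 + (2 - alpha) * Rpower (w s) (- alpha / 2) * U (th s)))); trivial.
      intros x _; split.
      - apply (is_derive_minus (fun s => 2 * s) p); [auto_derive; trivial; ring | apply Dp].
      - pose proof (Hq x); lra. }
    rewrite (apex_p Hs) in H; lra. }
  assert (H : 2 * (0 * 0) - w 0 <= 2 * (t * t) - w t).
  { apply (derive_nonneg_le (fun s => 2 * (s * s) - w s) (fun s => 4 * s - 2 * p s)); trivial.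
    intros x Hx; split.
    - apply (is_derive_minus (fun s => 2 * (s * s)) w); [auto_derive; trivial; ring | apply Dw].
    - pose proof (Hp x (proj1 Hx)); lra. }
  rewrite (apex_w Hs) in H; lra.
Qed.

(** Up to time [T] the energy relation gives [J^2 >= m0 / 2], and [w] is at most
[2 (w0 + t^2)]; the angle swept is then at least [sqrt (m0 / 2) / 2] times
[atan (T / sqrt w0) / sqrt w0].  After [T] the momentum varies by at most
[8 M1 / sqrt (1 + T)], which keeps it nonnegative, so the angle no longer
decreases. *)
Lemma half_angle_lower (alpha : R) (U dU : R -> R) (m0 M0 M1 M2 w0 th0 l T : R) (w p th J : R -> R) :
  3 / 2 <= alpha <= 2 -> 0 < w0 <= 1 -> 1 <= T -> admissible U dU m0 M0 M1 M2 ->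
  8 * M1 / sqrt (1 + T) <= sqrt (m0 / 2) ->
  (2 - alpha) * M0 <= w0 -> / 2 <= Rpower w0 (1 - alpha / 2) ->
  Rpower (w0 + 2 * (T * T)) (1 - alpha / 2) <= (1 + m0 / (2 * M0)) * Rpower w0 (1 - alpha / 2) ->
  apex_solution alpha U dU w0 th0 w p th J -> is_lim th p_infty l ->
  sqrt (m0 / 2) * (PI / (8 * sqrt w0)) <= l - th0.
Proof.
  intros Ha Hw0 HT HU Htail HM Hhalf Hvar Hs Hl.
  pose proof (apex_polar Hs) as [Hw Dw Dp Dth DJ _].
  pose proof (adm_U HU th0) as HU0; pose proof (adm_m0 HU) as Hm0.
  assert (Hlow : forall t, w0 + t * t <= w t)
    by (intros t; apply (apex_lower_bound (proj2 Ha) HU Hs t)).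
  assert (HJ2 : forall t, 0 <= t <= T -> m0 / 2 <= J t * J t).
  { intros t Ht.
    pose proof (apex_momentum_lower t (proj2 Ha) (proj1 Hw0) HU Hs
      (proj1 Ht)) as HJ.
    assert (Hup : Rpower (w t) (1 - alpha / 2) <= (1 + m0 / (2 * M0)) * Rpower w0 (1 - alpha / 2)).
    { apply Rle_trans with (2 := Hvar). apply Rle_Rpower_l; [lra|]. split; [apply Hw|].
      apply Rle_trans with (w0 + 2 * (t * t)); [|nra].
      apply (apex_upper_bound alpha U dU m0 M0 M1 M2 w0 th0 w p th J); trivial; lra. }
    assert (Hdn : Rpower w0 (1 - alpha / 2) <= Rpower (w t) (1 - alpha / 2)).
    { apply Rle_Rpower_l; [lra|]. split; [lra|]. pose proof (Hlow t); nra. }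
    set (s := Rpower (w t) (1 - alpha / 2)) in *.
    set (s0 := Rpower w0 (1 - alpha / 2)) in *.
    assert (2 * M0 * (s - s0) <= m0 * s0).
    { replace (m0 * s0) with (2 * M0 * (m0 / (2 * M0) * s0)) by (field; lra).
      apply Rmult_le_compat_l; lra. }
    nra. }
  assert (Hj : 0 < sqrt (m0 / 2)) by (apply sqrt_lt_R0; lra).
  assert (HJ : forall t, 0 <= t <= T -> sqrt (m0 / 2) <= J t).
  { intros t Ht.
    assert (HJpos : 0 < J t).
    { destruct (Rlt_dec 0 (J t)) as [Hp|Hn]; trivial; exfalso.
      assert (HJ0 : 0 <= J 0) by (rewrite (apex_J Hs); apply sqrt_pos).
      destruct (IVT_gen J 0 t 0) as [c [Hc Ec]].
      - intros x; apply continuity_pt_filterlim, (ex_derive_continuous (V := R_NormedModule) J).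
        eexists; apply DJ.
      - rewrite Rmin_right, Rmax_left; lra.
      - rewrite Rmin_left, Rmax_right in Hc by lra.
        pose proof (HJ2 c ltac:(lra)) as H; rewrite Ec in H; lra. }
    rewrite <- (sqrt_square (J t)) by lra.
    apply sqrt_le_1_alt; now apply HJ2. }
  assert (HJT : forall t, T <= t -> 0 <= J t).
  { intros t Ht.
    (* For [x >= T >= 1], [w x >= x^2 >= (1 + x^2) / 2], independently of [w0]. *)
    assert (H : Rabs (J t - J T) <= 2 * (M1 * (2 / (/ 2))) / sqrt (1 + T)).
    { apply decay_variation with (fun t => Rpower (w t) (- alpha / 2) * dU (th t)); [lra|].
      intros x Hx; split; [apply DJ|].
      rewrite Rabs_mult, Rabs_pos_eq by (left; apply exp_pos).
      rewrite Rmult_comm, Rmult_assoc.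
      apply Rmult_le_compat; [apply Rabs_pos | left; apply exp_pos | apply HU |].
      apply decay_Rpower_le; trivial; [lra|].
      pose proof (Hlow x); nra. }
    replace (2 * (M1 * (2 / (/ 2))) / sqrt (1 + T)) with (8 * M1 / sqrt (1 + T)) in H.
    2: { field. apply Rgt_not_eq, sqrt_lt_R0; lra. }
    pose proof (HJ T ltac:(lra)).
    pose proof (Rle_abs (- (J t - J T))) as Hb; rewrite Rabs_Ropp in Hb; lra. }
  assert (HS : 0 < sqrt w0) by (apply sqrt_lt_R0; lra).
  assert (HthT : sqrt (m0 / 2) * (PI / (8 * sqrt w0)) <= th T - th0).
  { set (j := sqrt (m0 / 2)) in *.
    assert (H : th 0 - j / 2 * (atan (0 / sqrt w0) / sqrt w0) <=
                th T - j / 2 * (atan (T / sqrt w0) / sqrt w0)).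
    { apply (derive_nonneg_le (fun t => th t - j / 2 * (atan (t / sqrt w0) / sqrt w0))
        (fun t => J t / w t - j / 2 * / (w0 + t * t))); [lra|].
      intros x Hx; split.
      - apply (is_derive_minus th (fun t => j / 2 * (atan (t / sqrt w0) / sqrt w0)));
          [apply Dth | apply is_derive_scal, is_derive_atan_scaled; lra].
      - assert (Hup : w x <= w0 + 2 * (x * x))
          by (apply (apex_upper_bound alpha U dU m0 M0 M1 M2 w0 th0 w p th J); trivial; lra).
        pose proof (HJ x Hx).
        assert (0 < w0 + x * x) by nra.
        assert (j / 2 * / (w0 + x * x) <= j * / w x).
        { replace (j / 2 * / (w0 + x * x)) with (j * / (2 * (w0 + x * x))) by (field; lra).
          apply Rmult_le_compat_l; [lra|]. apply Rinv_le_contravar; [apply Hw | nra]. }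
        assert (j * / w x <= J x / w x)
          by (apply Rmult_le_compat_r; [left; apply Rinv_0_lt_compat, Hw | trivial]).
        lra. }
    replace (0 / sqrt w0) with 0 in H by (field; lra).
    rewrite atan_0, (apex_th Hs) in H.
    assert (Hat : PI / 4 <= atan (T / sqrt w0)).
    { rewrite <- atan_1.
      assert (H1 : 1 <= T / sqrt w0).
      { assert (sqrt w0 <= 1) by (rewrite <- sqrt_1; apply sqrt_le_1_alt; lra).
        apply Rmult_le_reg_r with (sqrt w0); trivial.
        unfold Rdiv; rewrite Rmult_assoc, Rinv_l by lra; lra. }
      destruct H1 as [H1|H1]; [left; now apply atan_increasing | rewrite <- H1; lra]. }
    assert (j / 2 * (PI / 4 / sqrt w0) <= j / 2 * (atan (T / sqrt w0) / sqrt w0)).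
    { apply Rmult_le_compat_l; [lra|].
      apply Rmult_le_compat_r; [left; now apply Rinv_0_lt_compat | lra]. }
    replace (j * (PI / (8 * sqrt w0))) with (j / 2 * (PI / 4 / sqrt w0)) by (field; lra).
    unfold Rdiv in *; lra. }
  cut (th T <= l); [lra|].
  apply (is_lim_le_loc (fun _ => th T) th p_infty (th T) l); trivial; [|apply is_lim_const].
  exists T; intros x Hx.
  apply (derive_nonneg_le th (fun t => J t / w t)); [lra|].
  intros y Hy; split; [apply Dth|].
  apply Rmult_le_pos; [apply HJT; lra | left; apply Rinv_0_lt_compat, Hw].
Qed.

(** * Trajectories with prescribed asymptotic angles *)

(** [p - t] stays bounded because its derivative is integrable; hence [w - t^2] grows
at most linearly. *)
Lemma apex_radius_asymptotics (alpha : R) (U dU : R -> R) (m0 M0 M1 M2 w0 th0 : R) (w p th J : R -> R) :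
  3 / 2 <= alpha <= 2 -> 0 < w0 -> admissible U dU m0 M0 M1 M2 ->
  apex_solution alpha U dU w0 th0 w p th J ->
  exists c, forall t, Rabs (sqrt (w t) - Rabs t) <= c.
Proof.
  intros Ha Hw0 HU Hs.
  pose proof (apex_polar Hs) as [Hw Dw Dp _ _ _].
  assert (Hlow : forall t, w0 + t * t <= w t)
    by (intros t; apply (apex_lower_bound (proj2 Ha) HU Hs t)).
  (* [w >= c (1 + t^2)] with [c <= 1], as the decay estimate requires. *)
  set (c := Rmin w0 1).
  assert (Hc : 0 < c <= 1) by (unfold c; split; [apply Rmin_pos; lra | apply Rmin_r]).
  assert (Hcw : c <= w0) by apply Rmin_l.
  set (K := (2 - alpha) * M0 * (2 / c)).
  assert (Hp : forall t, Rabs (p t - t) <= 2 * K).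
  { intros t.
    replace (p t - t) with ((p t - t) - (p 0 - 0))
      by (rewrite (apex_p Hs); ring).
    apply (decay_bounded (fun t => p t - t)
      (fun t => 2 * / 2 + (2 - alpha) * Rpower (w t) (- alpha / 2) * U (th t) - 1)).
    intros x; split.
    - apply (is_derive_minus p (fun t => t)); [apply Dp | apply (is_derive_id x)].
    - replace (_ - 1) with ((2 - alpha) * (U (th x) * Rpower (w x) (- alpha / 2))) by field.
      pose proof (adm_U HU (th x)); pose proof (adm_m0 HU).
      assert (0 < Rpower (w x) (- alpha / 2)) by apply exp_pos.
      rewrite Rabs_pos_eq by (repeat apply Rmult_le_pos; lra).
      unfold K; rewrite !Rmult_assoc; apply Rmult_le_compat_l; [lra|].
      apply Rmult_le_compat; try lra.
      apply decay_Rpower_le; trivial.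
      pose proof (Hlow x); nra. }
  assert (HK : 0 <= 2 * K) by (apply Rle_trans with (2 := Hp 0), Rabs_pos).
  exists (2 * K + sqrt w0); intros t.
  assert (Hw' : Rabs ((w t - t * t) - (w 0 - 0 * 0)) <= 4 * K * Rabs (t - 0)).
  { apply (derive_bounded_lipschitz (fun t => w t - t * t) (fun t => 2 * p t - 2 * t)).
    intros z _; split.
    - apply (is_derive_minus w (fun t => t * t)); [apply Dw | auto_derive; trivial; ring].
    - replace (2 * p z - 2 * z) with (2 * (p z - z)) by ring.
      rewrite Rabs_mult, (Rabs_pos_eq 2) by lra. pose proof (Hp z); lra. }
  rewrite (apex_w Hs), Rminus_0_r in Hw'.
  apply Rabs_le_between in Hw'.
  assert (Hs0 : 0 < sqrt w0) by now apply sqrt_lt_R0.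
  assert (Hss : sqrt w0 * sqrt w0 = w0) by (apply sqrt_sqrt; lra).
  assert (Ht2 : Rabs t * Rabs t = t * t) by (rewrite <- Rabs_mult; apply Rabs_pos_eq; nra).
  pose proof (Rabs_pos t) as Ht.
  assert (H1 : Rabs t <= sqrt (w t)).
  { rewrite <- (sqrt_square (Rabs t)) by trivial.
    apply sqrt_le_1_alt; pose proof (Hlow t); lra. }
  assert (H2 : sqrt (w t) <= Rabs t + (2 * K + sqrt w0)).
  { rewrite <- (sqrt_square (Rabs t + (2 * K + sqrt w0))) by lra.
    apply sqrt_le_1_alt.
    pose proof (Rmult_le_pos _ _ Ht (Rlt_le _ _ Hs0)).
    pose proof (Rmult_le_pos _ _ HK (Rlt_le _ _ Hs0)).
    pose proof (Rmult_le_pos _ _ HK HK).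
    nra. }
  rewrite Rabs_pos_eq; lra.
Qed.

Lemma Rpower_near_1 (x eta : R) :
  0 < eta ->
  exists delta, 0 < delta /\ forall e, Rabs e < delta -> Rabs (Rpower x e - 1) < eta.
Proof.
  intros He.
  assert (Hc : continuous (fun e => Rpower x e) 0).
  { apply (ex_derive_continuous (V := R_NormedModule)); unfold Rpower; auto_derive; trivial. }
  destruct (Hc (fun r => Rabs (r - 1) < eta)) as [d Hd].
  { replace (Rpower x 0) with 1 by (unfold Rpower; rewrite Rmult_0_l, exp_0; trivial).
    exists (mkposreal eta He); intros r Hr; exact Hr. }
  exists d; split; [apply cond_pos|].
  intros e Hde; apply Hd.
  change (Rabs (e - 0) < d); now rewrite Rminus_0_r.
Qed.

(** Zeros of [D - (Tp - Tm)] and [Tm - thm] on a rectangle, by Poincare-Miranda in the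
variables [w0] and [th0].  The time [T] depends on the angular profile only; it is
followed by the small value [w1] of [w0], then by the large one [w2], and [alpha]
is chosen close to [2] last, in terms of [w1] and [T]. *)
Lemma polar_connection_pos (U dU : R -> R) (m0 M0 M1 M2 D : R) :
  admissible U dU m0 M0 M1 M2 -> PI < D ->
  exists alphabar, 0 < alphabar < 2 /\ forall alpha, alphabar < alpha < 2 -> forall thm : R,
  exists w p th J c,
    polar_solution alpha U dU (/ 2) w p th J /\
    (forall t, Rabs (sqrt (w t) - Rabs t) <= c) /\
    is_lim th m_infty thm /\ is_lim th p_infty (thm + D).
Proof.
  intros HU HD.
  pose proof PI_RGT_0 as Hpi.
  pose proof (adm_U HU 0) as HU0; pose proof (adm_m0 HU) as Hm0.
  assert (HM1 : 0 <= M1)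
    by (apply Rle_trans with (2 := adm_dU HU 0), Rabs_pos).
  set (j := sqrt (m0 / 2)).
  assert (Hj : 0 < j) by (apply sqrt_lt_R0; lra).
  (* [T] is such that after [T] the momentum varies by at most [j], its lower
     bound up to [T]. *)
  set (q := 8 * M1 / j).
  assert (Hq : 0 <= q) by (apply Rmult_le_pos; [lra | left; now apply Rinv_0_lt_compat]).
  set (T := 1 + q * q).
  assert (HT : 1 <= T) by (unfold T; nra).
  assert (Htail : 8 * M1 / sqrt (1 + T) <= j).
  { assert (HsT : q <= sqrt (1 + T)).
    { rewrite <- (sqrt_square q) at 1 by lra. apply sqrt_le_1_alt; unfold T; lra. }
    assert (0 < sqrt (1 + T)) by (apply sqrt_lt_R0; lra).
    apply Rmult_le_reg_r with (sqrt (1 + T)); trivial.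
    unfold Rdiv at 1; rewrite Rmult_assoc, Rinv_l, Rmult_1_r by lra.
    replace (8 * M1) with (j * q) by (unfold q; field; lra).
    apply Rmult_le_compat_l; lra. }
  (* [s = sqrt w1]: each half of the trajectory then turns by at least [D]. *)
  set (s := Rmin 1 (j * PI / (8 * D))).
  assert (Hs : 0 < s <= 1).
  { unfold s; split; [|apply Rmin_l].
    apply Rmin_pos; [lra|]. apply Rdiv_lt_0_compat; nra. }
  assert (HsD : 8 * D * s <= j * PI).
  { apply Rle_trans with (8 * D * (j * PI / (8 * D))).
    - apply Rmult_le_compat_l; [lra | apply Rmin_r].
    - right; field; lra. }
  set (w1 := s * s).
  assert (Hw1 : 0 < w1 <= 1) by (unfold w1; nra).
  assert (Esw1 : sqrt w1 = s) by (apply sqrt_square; lra).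
  (* [S = sqrt w2]: then the upper bound [(1 + (M0 + 4 M1) / S) PI] is below [D]. *)
  set (S := 1 + (M0 + 4 * M1) * PI / (D - PI)).
  assert (HS : 1 < S).
  { unfold S. assert (0 < (M0 + 4 * M1) * PI / (D - PI))
      by (apply Rdiv_lt_0_compat; nra). lra. }
  assert (HSD : (M0 + 4 * M1) * PI < S * (D - PI)).
  { unfold S. replace ((1 + (M0 + 4 * M1) * PI / (D - PI)) * (D - PI))
      with ((D - PI) + (M0 + 4 * M1) * PI) by (field; lra). lra. }
  set (w2 := S * S).
  assert (Hw2 : 1 < w2) by (unfold w2; nra).
  assert (Esw2 : sqrt w2 = S) by (apply sqrt_square; lra).
  (* As [kappa <= 1/2], two powers within [kappa / 4] of [1] have a quotient below
     [1 + kappa] and are at least [1/2]. *)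
  set (kappa := m0 / (2 * M0)).
  assert (Hkappa : 0 < kappa <= / 2).
  { unfold kappa; split; [apply Rdiv_lt_0_compat; lra|].
    apply Rmult_le_reg_r with (2 * M0); [lra|].
    unfold Rdiv; rewrite Rmult_assoc, Rinv_l by lra; lra. }
  destruct (Rpower_near_1 w1 (kappa / 4) ltac:(lra)) as [d1 [Hd1 N1]].
  destruct (Rpower_near_1 (w1 + 2 * (T * T)) (kappa / 4) ltac:(lra)) as [d2 [Hd2 N2]].
  set (eps := Rmin (/ 2) (Rmin (w1 / M0) (Rmin d1 d2))).
  assert (HwM : 0 < w1 / M0) by (apply Rdiv_lt_0_compat; lra).
  assert (Heps : 0 < eps) by (unfold eps; repeat apply Rmin_pos; lra).
  assert (Heps0 : eps <= / 2) by apply Rmin_l.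
  assert (Heps1 : eps <= w1 / M0)
    by (apply Rle_trans with (1 := Rmin_r _ _); apply Rmin_l).
  assert (Heps2 : eps <= Rmin d1 d2)
    by (apply Rle_trans with (1 := Rmin_r _ _); apply Rmin_r).
  pose proof (Rmin_l d1 d2); pose proof (Rmin_r d1 d2).
  exists (2 - eps); split; [lra|].
  intros alpha Halpha thm.
  assert (Ha : 3 / 2 <= alpha <= 2) by lra.
  assert (HaM : (2 - alpha) * M0 <= w1).
  { replace w1 with (w1 / M0 * M0) by (field; lra). apply Rmult_le_compat_r; lra. }
  assert (He : Rabs (1 - alpha / 2) < eps) by (rewrite Rabs_pos_eq; lra).
  specialize (N1 (1 - alpha / 2) ltac:(lra)); specialize (N2 (1 - alpha / 2) ltac:(lra)).
  apply Rabs_def2 in N1; apply Rabs_def2 in N2.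
  assert (Hhalf : / 2 <= Rpower w1 (1 - alpha / 2)) by lra.
  assert (Hvar : Rpower (w1 + 2 * (T * T)) (1 - alpha / 2) <=
    (1 + kappa) * Rpower w1 (1 - alpha / 2)) by nra.
  (* The family is taken on a larger interval than [w1 <= w0 <= w2], whose end
     points must be interior for continuity. *)
  destruct (apex_family alpha U dU m0 M0 M1 M2 (w1 / 2) (w2 + 1) Ha ltac:(lra) HU)
    as [W [P [Th [J [Tm [Tp [C [HF HC]]]]]]]].
  assert (HC0 : 0 <= C).
  { destruct (HF w1 0 ltac:(lra)) as [_ [_ [_ H1]]].
    apply Rle_trans with (2 := H1), Rabs_pos. }
  destruct (poincare_miranda (fun w0 th0 => D - (Tp w0 th0 - Tm w0 th0))
    (fun w0 th0 => Tm w0 th0 - thm) w1 w2 (thm - (C + 1)) (thm + (C + 1)))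
    as [w0 [th0 [Hw0 [_ [E1 E2]]]]]; try lra.
  - intros a b Hab _.
    destruct (HC a b ltac:(lra)) as [Cm Cp]; split; intros e He0.
    + destruct (Cm (e / 2) ltac:(lra)) as [r1 [Hr1 K1]].
      destruct (Cp (e / 2) ltac:(lra)) as [r2 [Hr2 K2]].
      exists (Rmin r1 r2); split; [now apply Rmin_pos|].
      intros x y Hx Hy. pose proof (Rmin_l r1 r2); pose proof (Rmin_r r1 r2).
      specialize (K1 x y ltac:(lra) ltac:(lra)); specialize (K2 x y ltac:(lra) ltac:(lra)).
      replace (_ - _) with ((Tm x y - Tm a b) - (Tp x y - Tp a b)) by ring.
      apply Rle_lt_trans with (1 := Rabs_triang _ _); rewrite Rabs_Ropp; lra.
    + destruct (Cm e He0) as [r [Hr K1]]; exists r; split; trivial.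
      intros x y Hx Hy; replace (_ - _) with (Tm x y - Tm a b) by ring; auto.
  - intros b _; split.
    + destruct (HF w1 b ltac:(lra)) as [Hsol [Lm [Lp _]]].
      assert (H1 := half_angle_lower alpha U dU m0 M0 M1 M2 w1 b (Tp w1 b) T _ _ _ _
        Ha Hw1 HT HU Htail HaM Hhalf Hvar Hsol Lp).
      assert (H2 := half_angle_lower alpha _ _ m0 M0 M1 M2 w1 (- b) (- Tm w1 b) T _ _ _ _
        Ha Hw1 HT (admissible_reflect HU) Htail HaM Hhalf Hvar
        (apex_reflect Hsol) (is_lim_reflect_opp Lm)).
      fold j in H1, H2; rewrite Esw1 in H1, H2.
      assert (H3 : D <= j * (PI / (8 * s))).
      { apply Rmult_le_reg_r with (8 * s); [lra|].
        replace (j * (PI / (8 * s)) * (8 * s)) with (j * PI) by (field; lra). lra. }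
      lra.
    + destruct (HF w2 b ltac:(lra)) as [Hsol [Lm [Lp _]]].
      assert (H1 := half_angle_upper alpha U dU m0 M0 M1 M2 w2 b (Tp w2 b) _ _ _ _
        Ha ltac:(lra) HU Hsol Lp).
      assert (H2 := half_angle_upper alpha _ _ m0 M0 M1 M2 w2 (- b) (- Tm w2 b) _ _ _ _
        Ha ltac:(lra) (admissible_reflect HU)
        (apex_reflect Hsol) (is_lim_reflect_opp Lm)).
      rewrite Esw2 in H1, H2.
      assert (H3 : (1 + (M0 + 4 * M1) / S) * PI < D).
      { apply Rmult_lt_reg_r with S; [lra|].
        replace ((1 + (M0 + 4 * M1) / S) * PI * S) with (S * PI + (M0 + 4 * M1) * PI)
          by (field; lra). lra. }
      lra.
  - intros a Hab.
    destruct (HF a (thm - (C + 1)) ltac:(lra)) as [_ [_ [_ H1]]].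
    destruct (HF a (thm + (C + 1)) ltac:(lra)) as [_ [_ [_ H2]]].
    apply Rabs_le_between in H1; apply Rabs_le_between in H2; lra.
  - destruct (HF w0 th0 ltac:(lra)) as [Hsol [Lm [Lp _]]].
    destruct (apex_radius_asymptotics alpha U dU m0 M0 M1 M2 w0 th0 _ _ _ _
      Ha ltac:(lra) HU Hsol) as [c Hc].
    exists (W w0 th0), (P w0 th0), (Th w0 th0), (J w0 th0), c.
    split; [apply Hsol | split; [exact Hc|]].
    assert (Em : Tm w0 th0 = thm) by lra; assert (Ep : Tp w0 th0 = thm + D) by lra.
    rewrite Em in Lm; rewrite Ep in Lp; split; [exact Lm | exact Lp].
Qed.

Lemma polar_time_reversal (alpha : R) (U dU : R -> R) (h : R) (w p th J : R -> R) :
  polar_solution alpha U dU h w p th J ->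
  polar_solution alpha U dU h (fun t => w (- t)) (fun t => - p (- t))
    (fun t => th (- t)) (fun t => - J (- t)).
Proof.
  intros [Hw Dw Dp Dth DJ He].
  assert (Dneg : forall (y : R -> R) d t, is_derive y (- t) d ->
    is_derive (fun s => - y (- s)) t d).
  { intros y d t Hy; rewrite <- (Ropp_involutive d).
    apply (is_derive_opp (fun s => y (- s))), is_derive_reflect, Hy. }
  split; intros t.
  - apply Hw.
  - replace (2 * - p (- t)) with (- (2 * p (- t))) by ring.
    apply is_derive_reflect, Dw.
  - apply Dneg, Dp.
  - replace (- J (- t) / w (- t)) with (- (J (- t) / w (- t)))
      by (unfold Rdiv; ring).
    apply is_derive_reflect, Dth.
  - apply Dneg, DJ.
  - rewrite !Rmult_opp_opp; apply He.
Qed.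

(** A clockwise trajectory is a counterclockwise one run backwards, with the two
ends exchanged. *)
Lemma polar_connection (U dU : R -> R) (m0 M0 M1 M2 thp thm : R) :
  admissible U dU m0 M0 M1 M2 -> PI < Rabs (thp - thm) ->
  exists alphabar, 0 < alphabar < 2 /\ forall alpha, alphabar < alpha < 2 ->
  exists w p th J c,
    polar_solution alpha U dU (/ 2) w p th J /\
    (forall t, Rabs (sqrt (w t) - Rabs t) <= c) /\
    is_lim th m_infty thm /\ is_lim th p_infty thp.
Proof.
  intros HU HD.
  destruct (polar_connection_pos U dU m0 M0 M1 M2 _ HU HD) as [abar [Hab H]].
  exists abar; split; trivial; intros alpha Ha.
  destruct (Rle_dec thm thp) as [Hle|Hle].
  - destruct (H alpha Ha thm) as [w [p [th [J [c [H1 [H2 [H3 H4]]]]]]]].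
    exists w, p, th, J, c; split; [|split; [|split]]; trivial.
    rewrite Rabs_pos_eq in H4 by lra.
    replace (thm + (thp - thm)) with thp in H4 by ring; trivial.
  - destruct (H alpha Ha thp) as [w [p [th [J [c [H1 [H2 [H3 H4]]]]]]]].
    exists (fun t => w (- t)), (fun t => - p (- t)), (fun t => th (- t)),
      (fun t => - J (- t)), c.
    split; [now apply polar_time_reversal | split; [|split]].
    + intros t; rewrite <- (Rabs_Ropp t); apply H2.
    + rewrite Rabs_left in H4 by lra.
      replace (thp + - (thp - thm)) with thm in H4 by ring.
      apply is_lim_reflect.
      apply (is_lim_ext th); trivial. intros t; now rewrite Ropp_involutive.
    + intros P HP; destruct (H3 P HP) as [M HM]; exists (- M).
      intros x Hx; apply HM; lra.
Qed.

(** * Periodic angular data *)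

Lemma periodic_add_INR (f : R -> R) (per : R) (n : nat) (x : R) :
  (forall x, f (x + per) = f x) -> f (x + INR n * per) = f x.
Proof.
  intros Hf; induction n as [|n IH]; [simpl; f_equal; ring|].
  rewrite S_INR; replace (x + (INR n + 1) * per) with ((x + INR n * per) + per) by ring.
  now rewrite Hf.
Qed.

Lemma periodic_representative (f : R -> R) (per x : R) :
  0 < per -> (forall x, f (x + per) = f x) -> exists y, 0 <= y <= per /\ f y = f x.
Proof.
  intros Hper Hf.
  destruct (archimed (x / per)) as [A1 A2].
  set (k := (up (x / per) - 1)%Z).
  exists (x - IZR k * per); split.
  - unfold k; rewrite minus_IZR.
    assert (E : x = x / per * per) by (field; lra).
    rewrite E at 1 3. split; nra.
  - destruct (Z.le_gt_cases 0 k) as [Hk|Hk].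
    + rewrite <- (periodic_add_INR f per (Z.to_nat k) (x - IZR k * per) Hf).
      f_equal; rewrite INR_IZR_INZ, Z2Nat.id by lia; ring.
    + rewrite <- (periodic_add_INR f per (Z.to_nat (- k)) x Hf).
      f_equal; rewrite INR_IZR_INZ, Z2Nat.id by lia; rewrite opp_IZR; ring.
Qed.

Lemma periodic_max (f : R -> R) (per : R) :
  0 < per -> (forall x, f (x + per) = f x) -> (forall x, continuous f x) ->
  exists c, forall x, f x <= f c.
Proof.
  intros Hper Hf Hc.
  destruct (continuity_ab_maj f 0 per) as [c [Hmax _]]; [lra| |].
  - intros x _; apply continuity_pt_filterlim, Hc.
  - exists c; intros x.
    destruct (periodic_representative f per x Hper Hf) as [y [Hy <-]]; auto.
Qed.

Lemma periodic_derive (f : R -> R) (per : R) :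
  (forall x, ex_derive f x) -> (forall x, f (x + per) = f x) ->
  forall x, Derive f (x + per) = Derive f x.
Proof.
  intros Hd Hf x; symmetry; apply is_derive_unique.
  apply is_derive_ext with (fun x => f (x + per)); [exact Hf|].
  replace (Derive f (x + per)) with (scal 1 (Derive f (x + per)))
    by (unfold scal; simpl; unfold mult; simpl; ring).
  apply (is_derive_comp f (fun x => x + per)); [apply Derive_correct, Hd|].
  auto_derive; trivial; ring.
Qed.

(** By periodicity, continuity of [U], [U'] and [U''] gives uniform bounds. *)
Lemma admissible_angular (u : C -> R) :
  positive_C2_on_circle u ->
  exists m0 M0 M1 M2, admissible (angular u) (Derive (angular u)) m0 M0 M1 M2.
Proof.
  intros [Hpos HC2].
  set (U := angular u) in *.
  assert (H2pi : 0 < 2 * PI) by (pose proof PI_RGT_0; lra).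
  assert (D1 : forall x, ex_derive U x) by (intros x; apply (HC2 x)).
  assert (D2 : forall x, ex_derive (Derive U) x) by (intros x; apply (HC2 x)).
  assert (C2c : forall x, continuous (Derive (Derive U)) x) by (intros x; apply (HC2 x)).
  assert (P0 : forall x, U (x + 2 * PI) = U x).
  { intros x; unfold U, angular, cis.
    rewrite cos_plus, sin_plus, cos_2PI, sin_2PI; f_equal; f_equal; ring. }
  assert (P1 := periodic_derive U (2 * PI) D1 P0).
  assert (P2 := periodic_derive (Derive U) (2 * PI) D2 P1).
  assert (Hopp : forall f : R -> R, (forall x, continuous f x) -> (forall x, f (x + 2 * PI) = f x) ->
    exists A, forall x, Rabs (f x) <= A).
  { intros f Hc Hp.
    destruct (periodic_max f (2 * PI) H2pi Hp Hc) as [a Ha].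
    destruct (periodic_max (fun x => - f x) (2 * PI) H2pi) as [b Hb].
    - intros x; now rewrite Hp.
    - intros x; apply (continuous_opp f), Hc.
    - exists (Rmax (f a) (- f b)); intros x; apply Rabs_le.
      pose proof (Ha x); pose proof (Hb x).
      pose proof (Rmax_l (f a) (- f b)); pose proof (Rmax_r (f a) (- f b)); lra. }
  assert (U0c : forall x, continuous U x)
    by (intros x; apply (ex_derive_continuous (V := R_NormedModule)), D1).
  destruct (periodic_max U (2 * PI) H2pi P0 U0c) as [a Ha].
  destruct (periodic_max (fun x => - U x) (2 * PI) H2pi) as [b Hb].
  { intros x; now rewrite P0. }
  { intros x; apply (continuous_opp U), U0c. }
  destruct (Hopp (Derive U)) as [M1 HM1]; trivial.
  { intros x; apply (ex_derive_continuous (V := R_NormedModule)), D2. }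
  destruct (Hopp (Derive (Derive U))) as [M2 HM2]; trivial.
  exists (U b), (U a), M1, M2; split; trivial.
  - apply Hpos, Cmod_cis.
  - intros x; pose proof (Ha x); pose proof (Hb x); lra.
  - intros x; apply Derive_correct, D1.
  - intros x y; apply derive_bounded_lipschitz with (Derive (Derive U)).
    intros z _; split; [apply Derive_correct, D2 | apply HM2].
Qed.

(** * Bi-hyperbolic solutions *)

Theorem theorem1p3 :
  forall u : C -> R,
    positive_C2_on_circle u ->
    (forall theta0 : R,
       global_minimizer (angular u) theta0 ->
       Derive_n (angular u) 2 theta0 <> 0) ->
    forall theta_plus theta_minus : R,
      PI < Rabs (theta_plus - theta_minus) ->
      exists alphabar : R,
        0 < alphabar < 2 /\
        forall alpha : R, alphabar < alpha < 2 ->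
        forall h : R, 0 < h ->
        exists x : R -> C,
          energy_solution (potential alpha u) h x /\
          asymptotic_direction x h theta_plus p_infty /\
          asymptotic_direction x h theta_minus m_infty.
Proof.
  intros u Hu _ thp thm HD.
  destruct (admissible_angular u Hu) as [m0 [M0 [M1 [M2 HU]]]].
  destruct (polar_connection _ _ m0 M0 M1 M2 thp thm HU HD) as [abar [Hab H]].
  exists abar; split; trivial; intros alpha Ha h Hh.
  destruct (H alpha Ha) as [w [p [th [J [c [Hs [Hc [Lm Lp]]]]]]]].
  destruct (polar_rescale alpha h _ _ w p th J ltac:(lra) Hh Hs)
    as [lam [mu [Hlam [Hmu [Elam Hs']]]]].
  exists (polar_curve (fun t => lam * lam * w (t / mu)) (fun t => th (t / mu))).
  assert (Hr : forall t,
    Rabs (sqrt (lam * lam * w (t / mu)) - sqrt (2 * h) * Rabs t) <= lam * c).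
  { intros t.
    rewrite sqrt_mult_alt, sqrt_square by nra.
    replace (sqrt (2 * h) * Rabs t) with (lam * Rabs (t / mu)).
    - rewrite <- Rmult_minus_distr_l, Rabs_mult, (Rabs_pos_eq lam) by lra.
      apply Rmult_le_compat_l; [lra | apply Hc].
    - unfold Rdiv; rewrite Rabs_mult, (Rabs_pos_eq (/ mu))
        by (left; now apply Rinv_0_lt_compat).
      rewrite Elam; field; lra. }
  split; [|split].
  - eapply polar_energy_solution; [|exact Hs']. apply HU.
  - apply polar_asymptotic_direction with (lam * c); [now left | exact Hr |].
    intros P HP; destruct (Lp P HP) as [M HM]; exists (M * mu).
    intros x Hx; apply HM. apply Rmult_lt_reg_r with mu; trivial.
    unfold Rdiv; rewrite Rmult_assoc, Rinv_l by lra; lra.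
  - apply polar_asymptotic_direction with (lam * c); [now right | exact Hr |].
    intros P HP; destruct (Lm P HP) as [M HM]; exists (M * mu).
    intros x Hx; apply HM. apply Rmult_lt_reg_r with mu; trivial.
    unfold Rdiv; rewrite Rmult_assoc, Rinv_l by lra; lra.
Qed.
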